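(* For any finite-dimensional $\mathbf U$-module $M$, the composition map $$\mathcal T:=\Upsilon\circ\widetilde\zeta\circ T_{w_0}:M\longrightarrow M$$ is an isomorphism of $\mathbf U^\imath$-modules.
   Context: Let $q$ be an indeterminate and fix $r\in\mathbb N=\{0,1,2,\dots\}$. Put $\mathbb I=\{-r,\dots,r\}$, $\mathbb I^\imath=\{1,\dots,r\}$, $\Lambda=\bigoplus_a\mathbb Z\varepsilon_a$ ($a\in\{-r-\frac12,\dots,r+\frac12\}$) with $(\varepsilon_a,\varepsilon_b)=\delta_{ab}$, $\alpha_i=\varepsilon_{i-\frac12}-\varepsilon_{i+\frac12}$ ($i\in\mathbb I$), $\Pi=\{\alpha_i\}$, $\mathrm{ht}(\sum c_i\alpha_i)=\sum c_i$. $\mathbf U=\mathbf U_q(\mathfrak{sl}_{2r+2})$ is the $\mathbb Q(q)$-algebra generated by $E_{\alpha_i},F_{\alpha_i},K_{\alpha_i}^{\pm1}$ ($i\in\mathbb I$) with commuting $K$'s, $K_{\alpha_i}E_{\alpha_j}K_{\alpha_i}^{-1}=q^{(\alpha_i,\alpha_j)}E_{\alpha_j}$, $K_{\alpha_i}F_{\alpha_j}K_{\alpha_i}^{-1}=q^{-(\alpha_i,\alpha_j)}F_{\alpha_j}$, $[E_{\alpha_i},F_{\alpha_j}]=\delta_{ij}\frac{K_{\alpha_i}-K_{\alpha_i}^{-1}}{q-q^{-1}}$ and the quantum Serre relations. $\mathbf U^+,\mathbf U^0,\mathbf U^-$ are the subalgebras generated by the $E$'s, $K^{\pm1}$'s,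 $F$'s; $\mathbf U^-_{-\mu}$ is the weight $-\mu$ part. $\psi$ is the anti-linear ($q\mapsto q^{-1}$) bar involution of $\mathbf U$ fixing $E_{\alpha_i},F_{\alpha_i}$ and inverting $K_{\alpha_i}$. Finite-dimensional $\mathbf U$-modules are weight modules $M=\bigoplus_{\mu\in\Lambda}M_\mu$ with $K_{\alpha_i}$ acting on $M_\mu$ by $q^{(\alpha_i,\mu)}$, and $E_{\alpha_i}M_\mu\subset M_{\mu+\alpha_i}$, $F_{\alpha_i}M_\mu\subset M_{\mu-\alpha_i}$. $\mathbf U^\imath$ is the $\mathbb Q(q)$-subalgebra of $\mathbf U$ generated, for $i\in\mathbb I^\imath$, by $k_{\alpha_i}^{\pm1}=(K_{\alpha_i}K_{\alpha_{-i}}^{-1})^{\pm1}$, $e_{\alpha_i}=E_{\alpha_i}+K_{\alpha_i}^{-1}F_{\alpha_{-i}}$, $f_{\alpha_i}=F_{\alpha_i}K_{\alpha_{-i}}^{-1}+E_{\alpha_{-i}}$, and by $t=E_{\alpha_0}+qF_{\alpha_0}K_{\alpha_0}^{-1}+K_{\alpha_0}^{-1}$. (The paper presents $\mathbf U^\imath$ by generators and relations and embeds it in $\mathbf U$ this way.) It has its own anti-linear bar involution $\psi_\imath$, fixing $e_{\alpha_i},f_{\alpha_i},t$ and inverting $k_{\alpha_i}$. $\mathbf U$-modules are $\mathbf U^\imath$-modules by restriction. $\Upsilon=\sum_{\mu\in\mathbb N\Pi}\Upsilon_\mu$, $\Upsilon_\mu\in\mathbf U^-_{-\mu}$ (in the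 completion of $\mathbf U$ with respect to $\mathbf U^+\mathbf U^0\sum_{\mathrm{ht}(\mu)\ge N}\mathbf U^-_{-\mu}$), is the unique such element with $\Upsilon_0=1$ and $\psi_\imath(u)\Upsilon=\Upsilon\psi(u)$ for all $u\in\mathbf U^\imath$; it acts on any finite-dimensional $\mathbf U$-module. $\zeta:\Lambda\to\mathbb Q(q)^\times$ is a function with $\zeta(\mu+\alpha_0)=-q\,\zeta(\mu)$ and $\zeta(\mu+\alpha_i)=-q^{(\alpha_i,\mu+\alpha_i)-(\alpha_{-i},\mu)}\zeta(\mu)$ for all $\mu\in\Lambda$, $0\ne i\in\mathbb I$ (such $\zeta$ exists); $\widetilde\zeta(m)=\zeta(\mu)m$ for $m\in M_\mu$. $T_{w_0}$ is the braid group operator on $M$ attached to the longest element $w_0$ of $\mathfrak S_{2r+2}$: the product, along a reduced word of $w_0$, of the operators $T_{\alpha_i}(m)=\sum_{a,b,c\ge0;\,-a+b-c=(\lambda,\alpha_i)}(-1)^bq^{b-ac}E^{(a)}_{\alpha_i}F^{(b)}_{\alpha_i}E^{(c)}_{\alpha_i}m$, $m\in M_\lambda$, where $x^{(a)}=x^a/[a]!$, $[a]=(q^a-q^{-a})/(q-q^{-1})$. *)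

(* Defs.v *)
From HB Require Import structures.
From mathcomp Require Import all_boot all_order fingroup perm all_algebra.
From mathcomp Require Import generic_quotient.
From mathcomp Require Import boolp classical_sets functions cardinality fsbigop.

Set Implicit Arguments.
Unset Strict Implicit.
Unset Printing Implicit Defensive.

Import GRing.Theory.

Local Open Scope classical_set_scope.
Local Open Scope ring_scope.
Local Open Scope quotient_scope.

Notation Qq := {fraction {poly rat}}.

Definition q : Qq := tofrac 'X.

(* The field automorphism f(q) |-> f(q^-1), computed on a representing
   fraction. *)
Definition bar_eval (p : {poly rat}) : Qq :=
  (map_poly (fun a : rat => tofrac a%:P : Qq) p).[q^-1].
Definition bar (x : Qq) : Qq := bar_eval \n_(repr x) / bar_eval \d_(repr x).

Definition qint (a : nat) : Qq := (q ^+ a - q ^- a) / (q - q^-1).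
Definition qfact (a : nat) : Qq := \prod_(1 <= k < a.+1) qint k.

(* The index set {-r, ..., r} is shifted by r to {0, ..., 2r}, and
   {-r-1/2, ..., r+1/2} is shifted by r+1/2 to {0, ..., 2r+1}. Thus 0 becomes
   [mid r], -i becomes [rev_ord i], i > 0 becomes [mid r < i], and i-1/2, i+1/2
   become [lo i], [hi i]. *)
Notation idx r := 'I_(r.*2.+1).

Lemma mid_subproof (r : nat) : (r < r.*2.+1)%N.
Proof. by rewrite ltnS -addnn leq_addr. Qed.

Definition mid (r : nat) : idx r := Ordinal (mid_subproof r).
Definition lo (r : nat) (i : idx r) : 'I_(r.*2.+2) := widen_ord (leqnSn _) i.
Definition hi (r : nat) (i : idx r) : 'I_(r.*2.+2) := lift ord0 i.

Notation Lam r := 'rV[int]_(r.*2.+2).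

Definition pairing (r : nat) (mu nu : Lam r) : int := \sum_a mu 0 a * nu 0 a.
Definition alpha (r : nat) (i : idx r) : Lam r :=
  delta_mx 0 (lo i) - delta_mx 0 (hi i).

(* [c] encodes the element sum_i c_i alpha_i of the positive root cone. *)
Notation NPi r := {ffun idx r -> nat}.
Definition rootsum (r : nat) (c : NPi r) : Lam r := \sum_i alpha i *+ c i.
Definition ht (r : nat) (c : NPi r) : nat := (\sum_i c i)%N.

(* U is the quotient of the algebra of noncommutative expressions in the
   generators by the smallest algebra congruence containing the defining
   relations. *)
Inductive expr (r : nat) : Type :=
  | TE of idx r
  | TF of idx r
  | TK of idx r
  | TKv of idx r
  | TC of Qq
  | TAdd of expr r & expr r
  | TMul of expr r & expr r.

Arguments TC {r} _%_R.
Declare Scope expr_scope.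
Delimit Scope expr_scope with X.
Local Notation "x + y" := (TAdd x y) : expr_scope.
Local Notation "x * y" := (TMul x y) : expr_scope.
Local Notation "x - y" := (TAdd x (TMul (TC (-1)) y)) : expr_scope.

Inductive cong (r : nat) : expr r -> expr r -> Prop :=
  | cong_refl x : cong x x
  | cong_sym x y : cong x y -> cong y x
  | cong_trans x y z : cong x y -> cong y z -> cong x z
  | cong_add x x' y y' : cong x x' -> cong y y' -> cong (x + y)%X (x' + y')%X
  | cong_mul x x' y y' : cong x x' -> cong y y' -> cong (x * y)%X (x' * y')%X
  | cong_addA x y z : cong (x + (y + z))%X (x + y + z)%X
  | cong_addC x y : cong (x + y)%X (y + x)%X
  | cong_add0 x : cong (TC 0 + x)%X x
  | cong_addN x : cong (TC (-1) * x + x)%X (TC 0)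
  | cong_mulA x y z : cong (x * (y * z))%X (x * y * z)%X
  | cong_mul1l x : cong (TC 1 * x)%X x
  | cong_mul1r x : cong (x * TC 1)%X x
  | cong_mulDl x y z : cong ((x + y) * z)%X (x * z + y * z)%X
  | cong_mulDr x y z : cong (x * (y + z))%X (x * y + x * z)%X
  | cong_cstD a b : cong (TC (a + b)) (TC a + TC b)%X
  | cong_cstM a b : cong (TC (a * b)) (TC a * TC b)%X
  | cong_cstC a x : cong (TC a * x)%X (x * TC a)%X
  | cong_KKv i : cong (TK i * TKv i)%X (TC 1)
  | cong_KvK i : cong (TKv i * TK i)%X (TC 1)
  | cong_KK i j : cong (TK i * TK j)%X (TK j * TK i)%X
  | cong_KE i j : cong (TK i * TE j * TKv i)%X
                       (TC (q ^ pairing (alpha i) (alpha j)) * TE j)%X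
  | cong_KF i j : cong (TK i * TF j * TKv i)%X
                       (TC (q ^ (- pairing (alpha i) (alpha j))) * TF j)%X
  | cong_EF i j : cong (TE i * TF j - TF j * TE i)%X
      (TC ((i == j)%:R / (q - q^-1)) * (TK i - TKv i))%X
  | cong_EE0 i j : pairing (alpha i) (alpha j) = 0 ->
      cong (TE i * TE j)%X (TE j * TE i)%X
  | cong_FF0 i j : pairing (alpha i) (alpha j) = 0 ->
      cong (TF i * TF j)%X (TF j * TF i)%X
  | cong_EE1 i j : pairing (alpha i) (alpha j) = -1 ->
      cong (TE i * TE i * TE j + TE j * TE i * TE i)%X
           (TC (q + q^-1) * (TE i * TE j * TE i))%X
  | cong_FF1 i j : pairing (alpha i) (alpha j) = -1 ->
      cong (TF i * TF i * TF j + TF j * TF i * TF i)%X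
           (TC (q + q^-1) * (TF i * TF j * TF i))%X.

(* The counit; it shows that U is nonzero. *)
Fixpoint counit (r : nat) (t : expr r) : Qq :=
  match t with
  | TE _ | TF _ => 0
  | TK _ | TKv _ => 1
  | TC a => a
  | TAdd x y => counit x + counit y
  | TMul x y => counit x * counit y
  end.

Lemma counit_cong (r : nat) (x y : expr r) : cong x y -> counit x = counit y.
Proof.
elim=> {x y} //=; do ?[by move=> *; congruence];
  do ?[by move=> *; rewrite ?(mul0r, mulr0, subrr, add0r, addr0)];
  do ?[by move=> *; rewrite ?(addrA, mulrA, mulrDl, mulrDr, mul1r, mulr1)];
  do ?[by move=> *; rewrite ?(mulN1r, addNr, subrr, mul1r, mulr0, addr0)].
- by move=> x y; exact: addrC.
- by move=> a x; exact: mulrC.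
Qed.

HB.instance Definition _ (r : nat) := gen_eqMixin (expr r).
HB.instance Definition _ (r : nat) := gen_choiceMixin (expr r).

Section QuantumGroup.
Variable r : nat.

Definition congb (x y : expr r) : bool := `[< cong x y >].

Lemma congb_refl : reflexive congb.
Proof. by move=> x; apply/asboolP; exact: cong_refl. Qed.

Lemma congb_sym : symmetric congb.
Proof.
by move=> x y; apply/asboolP/asboolP => h; exact: cong_sym.
Qed.

Lemma congb_trans : transitive congb.
Proof.
by move=> y x z /asboolP xy /asboolP yz; apply/asboolP; exact: cong_trans yz.
Qed.

Canonical congb_equiv := EquivRel congb congb_refl congb_sym congb_trans.

Definition U := {eq_quot congb}.
HB.instance Definition _ : EqQuotient _ congb U := EqQuotient.on U.
HB.instance Definition _ := Choice.on U.

Definition mkU (t : expr r) : U := \pi_U t.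

Lemma mkUP (x y : expr r) : mkU x = mkU y <-> cong x y.
Proof.
by rewrite /mkU; split=> [/eqmodP/asboolP|h] //; apply/eqmodP/asboolP.
Qed.

Lemma mkUK (u : U) : mkU (repr u) = u.
Proof. exact: reprK. Qed.

Lemma U_expr (u : U) : exists t, u = mkU t.
Proof. by exists (repr u); rewrite mkUK. Qed.

Lemma repr_cong (t : expr r) : cong (repr (mkU t)) t.
Proof. by apply/mkUP; exact: mkUK. Qed.

Definition addU (u v : U) := mkU (repr u + repr v)%X.
Definition mulU (u v : U) := mkU (repr u * repr v)%X.
Definition oppU (u : U) := mkU (TC (-1) * repr u)%X.
Definition scaleU (a : Qq) (u : U) := mkU (TC a * repr u)%X.

Let addE x y : addU (mkU x) (mkU y) = mkU (x + y)%X.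
Proof. by apply/mkUP; apply: cong_add; exact: repr_cong. Qed.
Let mulE x y : mulU (mkU x) (mkU y) = mkU (x * y)%X.
Proof. by apply/mkUP; apply: cong_mul; exact: repr_cong. Qed.
Let oppE x : oppU (mkU x) = mkU (TC (-1) * x)%X.
Proof. by apply/mkUP; apply: cong_mul; [exact: cong_refl|exact: repr_cong]. Qed.
Let scaleE a x : scaleU a (mkU x) = mkU (TC a * x)%X.
Proof. by apply/mkUP; apply: cong_mul; [exact: cong_refl|exact: repr_cong]. Qed.

Let addUA : associative addU.
Proof.
move=> u v w; case: (U_expr u) (U_expr v) (U_expr w) => x -> [y ->] [z ->].
by rewrite !addE; apply/mkUP; exact: cong_addA.
Qed.
Let addUC : commutative addU.
Proof.
move=> u v; case: (U_expr u) (U_expr v) => x -> [y ->].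
by rewrite !addE; apply/mkUP; exact: cong_addC.
Qed.
Let add0U : left_id (mkU (TC 0)) addU.
Proof.
move=> u; case: (U_expr u) => x ->.
by rewrite addE; apply/mkUP; exact: cong_add0.
Qed.
Let addNU : left_inverse (mkU (TC 0)) oppU addU.
Proof.
move=> u; case: (U_expr u) => x ->.
by rewrite oppE addE; apply/mkUP; exact: cong_addN.
Qed.
HB.instance Definition _ := GRing.isZmodule.Build U addUA addUC add0U addNU.

Let mulUA : associative mulU.
Proof.
move=> u v w; case: (U_expr u) (U_expr v) (U_expr w) => x -> [y ->] [z ->].
by rewrite !mulE; apply/mkUP; exact: cong_mulA.
Qed.
Let mul1U : left_id (mkU (TC 1)) mulU.
Proof.
move=> u; case: (U_expr u) => x ->.
by rewrite mulE; apply/mkUP; exact: cong_mul1l.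
Qed.
Let mulU1 : right_id (mkU (TC 1)) mulU.
Proof.
move=> u; case: (U_expr u) => x ->.
by rewrite mulE; apply/mkUP; exact: cong_mul1r.
Qed.
Let mulUDl : left_distributive mulU addU.
Proof.
move=> u v w; case: (U_expr u) (U_expr v) (U_expr w) => x -> [y ->] [z ->].
by rewrite !(addE, mulE); apply/mkUP; exact: cong_mulDl.
Qed.
Let mulUDr : right_distributive mulU addU.
Proof.
move=> u v w; case: (U_expr u) (U_expr v) (U_expr w) => x -> [y ->] [z ->].
by rewrite !(addE, mulE); apply/mkUP; exact: cong_mulDr.
Qed.
Let oneU_neq0 : mkU (TC 1) != mkU (TC 0).
Proof.
by apply/eqP => /mkUP/counit_cong /= /eqP; rewrite oner_eq0.
Qed.
HB.instance Definition _ := GRing.Zmodule_isNzRing.Build U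
  mulUA mul1U mulU1 mulUDl mulUDr oneU_neq0.

Let scaleUA a b (u : U) : scaleU a (scaleU b u) = scaleU (a * b) u.
Proof.
case: (U_expr u) => x ->; rewrite !scaleE; apply/mkUP.
apply: cong_trans (cong_mulA _ _ _) _.
by apply: cong_mul; [exact/cong_sym/cong_cstM|exact: cong_refl].
Qed.
Let scale1U : left_id 1 scaleU.
Proof.
move=> u; case: (U_expr u) => x ->.
by rewrite scaleE; apply/mkUP; exact: cong_mul1l.
Qed.
Let scaleUDr : right_distributive scaleU +%R.
Proof.
move=> a u v; case: (U_expr u) (U_expr v) => x -> [y ->].
rewrite -[LHS]/(scaleU a (addU _ _)) -[RHS]/(addU _ _) !(addE, scaleE).
by apply/mkUP; exact: cong_mulDr.
Qed.
Let scaleUDl (u : U) : {morph scaleU^~ u : a b / a + b}.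
Proof.
move=> a b; case: (U_expr u) => x ->.
rewrite -[RHS]/(addU _ _) !(addE, scaleE); apply/mkUP.
apply: cong_trans (cong_mulDl _ _ _).
by apply: cong_mul; [exact: cong_cstD|exact: cong_refl].
Qed.
HB.instance Definition _ := GRing.Zmodule_isLmodule.Build Qq U
  scaleUA scale1U scaleUDr scaleUDl.

Let scaleUAl a (u v : U) : a *: (u * v) = a *: u * v.
Proof.
case: (U_expr u) (U_expr v) => x -> [y ->].
rewrite -[LHS]/(scaleU a (mulU _ _)).
rewrite -[RHS]/(mulU (scaleU a _) _) !(mulE, scaleE).
by apply/mkUP; exact: cong_mulA.
Qed.
HB.instance Definition _ := GRing.Lmodule_isLalgebra.Build Qq U scaleUAl.

Let scaleUAr a (u v : U) : a *: (u * v) = u * (a *: v).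
Proof.
case: (U_expr u) (U_expr v) => x -> [y ->].
rewrite -[LHS]/(scaleU a (mulU _ _)).
rewrite -[RHS]/(mulU _ (scaleU a _)) !(mulE, scaleE).
apply/mkUP; apply: cong_trans (cong_mulA _ _ _) _.
apply: cong_trans (cong_sym (cong_mulA _ _ _)).
by apply: cong_mul; [exact: cong_cstC|exact: cong_refl].
Qed.
HB.instance Definition _ := GRing.Lalgebra_isAlgebra.Build Qq U scaleUAr.

Definition E (i : idx r) : U := mkU (TE i).
Definition F (i : idx r) : U := mkU (TF i).
Definition K (i : idx r) : U := mkU (TK i).
Definition Kv (i : idx r) : U := mkU (TKv i).

Lemma mkUD (x y : expr r) : mkU (x + y)%X = mkU x + mkU y.
Proof. by rewrite -addE. Qed.
Lemma mkUM (x y : expr r) : mkU (x * y)%X = mkU x * mkU y.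
Proof. by rewrite -mulE. Qed.
Lemma mkU1 : mkU (TC 1) = 1. Proof. by []. Qed.
Lemma mkU_cst (a : Qq) : mkU (TC a) = a%:A.
Proof.
by rewrite /GRing.scale /= -mkU1 scaleE; apply/mkUP/cong_sym/cong_mul1r.
Qed.

Definition mkUE := (mkUD, mkUM, mkU_cst, mulr_algl, scaleN1r).

Lemma KKv i : K i * Kv i = 1.
Proof. by move/mkUP: (cong_KKv i); rewrite !mkUE scale1r. Qed.
Lemma KvK i : Kv i * K i = 1.
Proof. by move/mkUP: (cong_KvK i); rewrite !mkUE scale1r. Qed.
Lemma KK i j : K i * K j = K j * K i.
Proof. by move/mkUP: (cong_KK i j); rewrite !mkUE. Qed.
Lemma KE i j : K i * E j * Kv i = q ^ pairing (alpha i) (alpha j) *: E j.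
Proof. by move/mkUP: (cong_KE i j); rewrite !mkUE. Qed.
Lemma KF i j : K i * F j * Kv i = q ^ (- pairing (alpha i) (alpha j)) *: F j.
Proof. by move/mkUP: (cong_KF i j); rewrite !mkUE. Qed.
Lemma EF i j :
  E i * F j - F j * E i = ((i == j)%:R / (q - q^-1)) *: (K i - Kv i).
Proof. by move/mkUP: (cong_EF i j); rewrite !mkUE. Qed.
Lemma EE0 i j : pairing (alpha i) (alpha j) = 0 -> E i * E j = E j * E i.
Proof. by move/cong_EE0/mkUP; rewrite !mkUE. Qed.
Lemma FF0 i j : pairing (alpha i) (alpha j) = 0 -> F i * F j = F j * F i.
Proof. by move/cong_FF0/mkUP; rewrite !mkUE. Qed.
Lemma EE1 i j : pairing (alpha i) (alpha j) = -1 ->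
  E i * E i * E j + E j * E i * E i = (q + q^-1) *: (E i * E j * E i).
Proof. by move/cong_EE1/mkUP; rewrite !mkUE. Qed.
Lemma FF1 i j : pairing (alpha i) (alpha j) = -1 ->
  F i * F i * F j + F j * F i * F i = (q + q^-1) *: (F i * F j * F i).
Proof. by move/cong_FF1/mkUP; rewrite !mkUE. Qed.

End QuantumGroup.

Inductive subalg_gen (A : algType Qq) (X : set A) : set A :=
  | subalg_mem x : X x -> subalg_gen X x
  | subalg_one : subalg_gen X 1
  | subalg_add x y : subalg_gen X x -> subalg_gen X y -> subalg_gen X (x + y)
  | subalg_mul x y : subalg_gen X x -> subalg_gen X y -> subalg_gen X (x * y)
  | subalg_scale a x : subalg_gen X x -> subalg_gen X (a *: x).

Definition Uplus (r : nat) : set (U r) := subalg_gen (range (@E r)).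
Definition Uzero (r : nat) : set (U r) :=
  subalg_gen (range (@K r) `|` range (@Kv r)).
Definition Uminus (r : nat) : set (U r) := subalg_gen (range (@F r)).

Definition Uminus_wt (r : nat) (c : NPi r) : set (U r) :=
  [set x | Uminus x /\ forall i,
    K i * x * Kv i = q ^ pairing (alpha i) (- rootsum c) *: x].

(* The span of the products U^+ U^0 U^-_{-mu} with ht(mu) >= N. *)
Inductive filt (r : nat) (N : nat) : set (U r) :=
  | filt0 : filt N 0
  | filt_add c (x y z v : U r) : (N <= ht c)%N ->
      Uplus x -> Uzero y -> Uminus_wt c z -> filt N v ->
      filt N (x * y * z + v).

(* The elements of the completion of U are represented by Cauchy sequences,
   with termwise operations; two of them are equal when their difference is
   eventually in every [filt N]. Left multiplications preserve [filt N] and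
   right multiplications shift [N] by a bounded amount. *)
Definition compl_eq (r : nat) (x y : nat -> U r) : Prop :=
  forall N, exists n0, forall n, (n0 <= n)%N -> filt N (x n - y n).

(* The sum of the Upsilon_mu with ht(mu) < n. *)
Definition Ups_trunc (r : nat) (Ups : NPi r -> U r) (n : nat) : U r :=
  \sum_(c : {ffun idx r -> 'I_n} |
          (ht [ffun i => c i : nat] < n)%N) Ups [ffun i => c i : nat].

Section Coideal.
Variable r : nat.
Implicit Type i : idx r.

Definition kI i : U r := K i * Kv (rev_ord i).
Definition kvI i : U r := Kv i * K (rev_ord i).
Definition eI i : U r := E i + Kv i * F (rev_ord i).
Definition fI i : U r := F i * Kv (rev_ord i) + E (rev_ord i).
Definition tI : U r :=
  E (mid r) + q *: (F (mid r) * Kv (mid r)) + Kv (mid r).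

Definition Uiota : set (U r) := subalg_gen
  [set x | x = tI \/ exists2 i : idx r, (mid r < i)%N &
    [\/ x = kI i, x = kvI i, x = eI i | x = fI i]].

End Coideal.

(* [psi] restricts to an anti-linear involutive ring automorphism of the
   subalgebra [S]; its values outside [S] are irrelevant. *)
Definition antilinear_involution (r : nat) (S : set (U r)) (psi : U r -> U r) :
    Prop :=
  [/\ (forall u, S u -> S (psi u)) /\ (forall u, S u -> psi (psi u) = u),
      psi 1 = 1,
      forall u v, S u -> S v -> psi (u + v) = psi u + psi v,
      forall u v, S u -> S v -> psi (u * v) = psi u * psi v
    & forall a u, S u -> psi (a *: u) = bar a *: psi u].

Definition bar_involution (r : nat) (psi : U r -> U r) : Prop :=
  antilinear_involution setT psi /\
  forall i, [/\ psi (E i) = E i, psi (F i) = F i & psi (K i) = Kv i].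

Definition ibar_involution (r : nat) (psii : U r -> U r) : Prop :=
  [/\ antilinear_involution (@Uiota r) psii,
      psii (tI r) = tI r
    & forall i : idx r, (mid r < i)%N ->
        [/\ psii (eI i) = eI i, psii (fI i) = fI i & psii (kI i) = kvI i]].

Definition intertwiner (r : nat) (psi psii : U r -> U r) (Ups : NPi r -> U r) :
    Prop :=
  [/\ forall c, Uminus_wt c (Ups c),
      Ups [ffun=> 0%N] = 1
    & forall u, Uiota u -> compl_eq (fun n => psii u * Ups_trunc Ups n)
                                    (fun n => Ups_trunc Ups n * psi u)].

Definition zeta_function (r : nat) (zeta : Lam r -> Qq) : Prop :=
  [/\ forall mu, zeta mu != 0,
      forall mu, zeta (mu + alpha (mid r)) = - q * zeta mu
    & forall mu i, i != mid r -> zeta (mu + alpha i) =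
        - q ^ (pairing (alpha i) (mu + alpha i)
               - pairing (alpha (rev_ord i)) mu) * zeta mu].

Definition wt_decomposition (r : nat) (M : vectType Qq)
    (wt : Lam r -> {vspace M}) (m : M) (f : Lam r -> M) : Prop :=
  [/\ forall mu, f mu \in wt mu,
      finite_set [set mu | f mu != 0]
    & m = \sum_(mu \in [set: Lam r]) f mu].

(* A finite-dimensional weight module with underlying vector space [M]. *)
Record weight_module (r : nat) (M : vectType Qq) := WeightModule {
  act : {linear U r -> 'End(M)};
  act1 : act 1 = \1%VF;
  actM : forall u v, act (u * v) = (act u \o act v)%VF;
  wt : Lam r -> {vspace M};
  wt_direct : forall m, exists! f, wt_decomposition wt m f;
  act_K : forall i mu m, m \in wt mu ->
    act (K i) m = q ^ pairing (alpha i) mu *: m;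
  act_E : forall i mu m, m \in wt mu -> act (E i) m \in wt (mu + alpha i);
  act_F : forall i mu m, m \in wt mu -> act (F i) m \in wt (mu - alpha i)
}.

Section Operators.
Variables (r : nat) (M : vectType Qq) (rho : weight_module r M).

Lemma wt_exists (m : M) : exists f, wt_decomposition (wt rho) m f.
Proof. by have [f [hf _]] := wt_direct rho m; exists f. Qed.

(* The component of [m] in the weight space of weight [mu]. *)
Definition wt_proj (mu : Lam r) (m : M) : M := sval (cid (wt_exists m)) mu.

Definition zeta_tilde (zeta : Lam r -> Qq) (m : M) : M :=
  \sum_(mu \in [set: Lam r]) zeta mu *: wt_proj mu m.

Definition divpow (u : U r) (a : nat) : U r := (qfact a)^-1 *: u ^+ a.

(* A triple [p] is (a, b, c); only finitely many terms are nonzero, as the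
   [E i] and [F i] act nilpotently. *)
Definition braid_wt (i : idx r) (lam : Lam r) (m : M) : M :=
  \sum_(p \in [set p : nat * nat * nat |
      - p.1.1%:Z + p.1.2%:Z - p.2%:Z = pairing lam (alpha i)])
    ((-1) ^+ p.1.2 * q ^ (p.1.2%:Z - (p.1.1 * p.2)%:Z)) *:
      act rho (divpow (E i) p.1.1 * divpow (F i) p.1.2 * divpow (E i) p.2) m.

Definition braid (i : idx r) (m : M) : M :=
  \sum_(lam \in [set: Lam r]) braid_wt i lam (wt_proj lam m).

Definition braid_word (w : seq (idx r)) (m : M) : M := foldr braid m w.

Definition Ups_act (Ups : NPi r -> U r) (m : M) : M :=
  \sum_(c \in [set: NPi r]) act rho (Ups c) m.

Definition Uiota_isomorphism (T : M -> M) : Prop :=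
  [/\ linear T, bijective T
    & forall u, Uiota u -> forall m, T (act rho u m) = act rho u (T m)].

End Operators.

Definition word_perm (r : nat) (w : seq (idx r)) : 'S_(r.*2.+2) :=
  (\prod_(i <- w) tperm (lo i) (hi i))%g.

Definition reduced (r : nat) (w : seq (idx r)) : Prop :=
  forall w', word_perm w' = word_perm w -> (size w <= size w')%N.

(* [w] is a reduced word of the longest element w_0. *)
Definition longest_reduced (r : nat) (w : seq (idx r)) : Prop :=
  reduced w /\ forall w' : seq (idx r), reduced w' -> (size w' <= size w)%N.

(* Main.v *)
(* Substituting psi_i(u) for u in the intertwining relation gives
   u Upsilon = Upsilon psi(psi_i(u)) for u in U^i, so it suffices to prove
   psi(psi_i(u)) zeta T_{w_0} = zeta T_{w_0} u for the generators u, each of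
   which psi_i fixes or inverts.  This follows from
     T_{w_0} E_i = - F_{-i} K_{-i} T_{w_0},
     T_{w_0} F_i = - K_{-i}^{-1} E_{-i} T_{w_0}
   and the recursions defining zeta.

   For these two formulas write w_0 = u s_i, where u sends alpha_i to
   alpha_{-i}.  The operator T_i is computed on the strings F_i^(k) v of
   highest weight vectors v, which span every finite-dimensional module; this
   gives T_i E_i = - F_i K_i T_i, T_i F_i = - K_i^{-1} E_i T_i and, for
   adjacent i and j, T_i T_j E_i = E_j T_i T_j and T_i T_j F_i = F_j T_i T_j.
   The last two relations imply the braid relations, and with them that T_u
   carries E_i, F_i to E_{-i}, F_{-i}.

   T is bijective because each T_i is onto, zeta is diagonal and Upsilon is
   unipotent with respect to the height of weights. *)

From HB Require Import structures.
Require Import Defs.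
From mathcomp Require Import all_boot all_order fingroup perm all_algebra.
From mathcomp Require Import generic_quotient.
From mathcomp Require Import boolp classical_sets functions cardinality fsbigop.
From mathcomp Require Import ring zify.

Set Implicit Arguments.
Unset Strict Implicit.
Unset Printing Implicit Defensive.

Import GRing.Theory.

Local Open Scope ring_scope.

(** * Quantum integers *)

(** In the triple sum defining T_i, evaluated on a string, the sum over a for fixed c is an
    alternating q-binomial sum. Expanding it in powers of q, every exponent that occurs is a root of
    a Gauss product, apart from a single one when c = 0; hence only one term survives. The relations
    for F are not computed separately. Exchanging E and F and negating weights preserves the rank
    one axioms, and T_i becomes an operator of the same shape with a parameter t = (-q)^-1 in place
    of 1. The powers of t cancel in T_i T_j. Since T_i is one universal expression in E_i, F_i and
    the weight, any map carrying these data for i to those for j carries T_i to T_j. The product T_i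
    T_j is such a map, and this is the braid relation. The reduced word of w_0 is arbitrary. In
    place of a preferred word, the argument uses that a right descent can be moved to the end of a
    word without changing the operator of the word. *)

Section QNumbers.
Variables (R : fieldType) (q : R).
Hypothesis q_neq0 : q != 0.
Hypothesis q_nroot : forall n : nat, (0 < n)%N -> q ^+ n != 1.

Definition qnum (n : int) : R := locked ((q ^ n - q ^ (- n)) / (q - q^-1)).

Lemma qnumE n : qnum n = (q ^ n - q ^ (- n)) / (q - q^-1).
Proof. by rewrite /qnum -lock. Qed.

Lemma expqD (m n : int) : q ^ (m + n) = q ^ m * q ^ n.
Proof. by rewrite expfzDr. Qed.

Lemma expqN (n : int) : q ^ (- n) = (q ^ n)^-1.
Proof. by rewrite invr_expz. Qed.

Lemma expq_neq0 (n : int) : q ^ n != 0.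
Proof. exact: expfz_neq0. Qed.

Lemma expq_neq1 (n : int) : n != 0 -> q ^ n != 1.
Proof.
case: n => [[|n]|n] // _; first exact: q_nroot.
by rewrite NegzE expqN invr_eq1; exact: q_nroot.
Qed.

Lemma expq_inj (a b : int) : q ^ a = q ^ b -> a = b.
Proof.
move=> h; apply/eqP; rewrite -subr_eq0; apply/negPn/negP => /expq_neq1.
by rewrite expqD h expqN divff ?eqxx // expq_neq0.
Qed.

Lemma subqV_neq0 : q - q^-1 != 0.
Proof.
have := q_nroot (isT : 0 < 2)%N; apply: contra => /eqP/subr0_eq h.
by rewrite expr2 {2}h divff.
Qed.

Lemma qnum0 : qnum 0 = 0.
Proof. by rewrite !qnumE oppr0 subrr mul0r. Qed.

Lemma qnum1 : qnum 1 = 1.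
Proof. by rewrite !qnumE expqN expr1z divff // subqV_neq0. Qed.

Lemma qnumN n : qnum (- n) = - qnum n.
Proof. by rewrite !qnumE opprK -mulNr opprB. Qed.

Lemma qnum_neq0 n : n != 0 -> qnum n != 0.
Proof.
move=> n0; rewrite !qnumE mulf_neq0 ?invr_neq0 ?subqV_neq0 // subr_eq0.
apply/eqP => h; have/negP := expq_neq1 (n := n + n) ltac:(lia); apply.
by rewrite expqD {2}h expqN divff // expq_neq0.
Qed.

Lemma qnum_add m n : qnum (m + n) = q ^ (- n) * qnum m + q ^ m * qnum n.
Proof.
rewrite !qnumE !opprD !expqD !expqN.
have x0 := expq_neq0 m; have y0 := expq_neq0 n; have d0 := subqV_neq0.
move: (q ^ m) (q ^ n) x0 y0 => x y x0 y0.
have q21 : q ^+ 2 - 1 != 0 by rewrite subr_eq0; exact: q_nroot.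
by field; rewrite ?x0 ?y0 ?q_neq0 ?q21.
Qed.

Lemma qnumS n : qnum (n + 1) = q * qnum n + q ^ (- n).
Proof. by rewrite addrC qnum_add qnum1 mulr1 expr1z addrC. Qed.

Lemma qnumSV n : qnum (n + 1) = q^-1 * qnum n + q ^ n.
Proof. by rewrite qnum_add qnum1 mulr1 expqN expr1z. Qed.

(** The scalar identity behind the induction step of [E_divpF]. *)
Lemma qnum_rel x y : qnum (x - y) + qnum (x + 1) * qnum y = qnum (y + 1) * qnum x.
Proof. by rewrite qnum_add !qnumSV qnumN opprK; ring. Qed.

(** The falling factorial [x][x-1]...[x-d+1]. The upper argument is an integer because weights enter
    there before highest weights are known to be natural numbers. *)
Fixpoint qfall (x : int) (d : nat) : R :=
  if d is d'.+1 then qfall x d' * qnum (x - d'%:Z) else 1.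
Definition qfac (d : nat) : R := qfall d%:Z d.
Definition qbin (x : int) (d : nat) : R := locked (qfall x d / qfac d).

Lemma qbinE x d : qbin x d = qfall x d / qfac d.
Proof. by rewrite /qbin -lock. Qed.

Lemma qfallS x d : qfall (x + 1) d.+1 = qnum (x + 1) * qfall x d.
Proof.
elim: d => [|d IH]; first by rewrite /= subr0 mulr1 mul1r.
have -> : qfall (x + 1) d.+2 = qfall (x + 1) d.+1 * qnum (x + 1 - d.+1%:Z) by [].
rewrite IH /= -mulrA; congr (_ * (_ * qnum _)); lia.
Qed.

Lemma qfacS d : qfac d.+1 = qnum d.+1%:Z * qfac d.
Proof. by rewrite /qfac (_ : d.+1%:Z = d%:Z + 1) ?qfallS // addrC. Qed.

Lemma qfac_neq0 d : qfac d != 0.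
Proof.
elim: d => [|d IH]; first exact: oner_neq0.
by rewrite qfacS mulf_neq0 // qnum_neq0.
Qed.

Lemma qfall_small (x d : nat) : (x < d)%N -> qfall x%:Z d = 0.
Proof.
elim: d => // d IH; rewrite ltnS leq_eqVlt => /orP[/eqP->|/IH /= ->];
  last by rewrite mul0r.
by rewrite /= subrr qnum0 mulr0.
Qed.

Lemma qbin_small (x d : nat) : (x < d)%N -> qbin x%:Z d = 0.
Proof. by move=> h; rewrite !qbinE qfall_small // mul0r. Qed.

Lemma qbin0 x : qbin x 0 = 1.
Proof. by rewrite !qbinE /qfac /= divr1. Qed.

Lemma qbinn (d : nat) : qbin d%:Z d = 1.
Proof. by rewrite !qbinE divff // qfac_neq0. Qed.

Lemma qbinS x d : qnum d.+1%:Z * qbin x d.+1 = qbin x d * qnum (x - d%:Z).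
Proof.
rewrite !qbinE /= qfacS; have := qfac_neq0 d; have := @qnum_neq0 d.+1%:Z isT.
by move: (qnum _) (qnum _) => y z y0 f0; field; rewrite y0 f0.
Qed.

Lemma qbinSS x d : qnum d.+1%:Z * qbin (x + 1) d.+1 = qnum (x + 1) * qbin x d.
Proof.
rewrite !qbinE qfallS qfacS; have := qfac_neq0 d; have := @qnum_neq0 d.+1%:Z isT.
by move: (qnum _) (qnum _) => y z y0 f0; field; rewrite y0 f0.
Qed.

(** The ratio of consecutive coefficients in [divp_add]. *)
Lemma qbin_top (b d : nat) : (qnum b.+1%:Z)^-1 * qbin (b + d)%N%:Z d * qnum (b +
  d).+1%:Z =
  qbin (b + d).+1%:Z d.
Proof.
have : qfall (b + d)%N.+1%:Z d * qnum b.+1%:Z =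
    qnum (b + d).+1%:Z * qfall (b + d)%N%:Z d.
  rewrite (_ : (b + d).+1%:Z = (b + d)%N%:Z + 1); last by lia.
  by rewrite -qfallS /=; congr (_ * qnum _); lia.
have := @qnum_neq0 b.+1%:Z isT; have := qfac_neq0 d; rewrite !qbinE.
move: (qnum b.+1%:Z) (qnum (b + d).+1%:Z) (qfac d) (qfall (b + d).+1%:Z d).
move: (qfall _ _) => z x y f w f0 x0 h.
have -> : w = (y * z) / x by rewrite -h mulfK.
by field; rewrite x0 f0.
Qed.

Lemma qpascal x a :
  qbin (x + 1) a.+1 = q ^ a.+1%:Z * qbin x a.+1 + q ^ (a%:Z - x) * qbin x a.
Proof.
have n0 := @qnum_neq0 a.+1%:Z isT; apply: (mulfI n0).
rewrite qbinSS mulrDr (mulrCA _ (q ^ a.+1%:Z)) qbinS.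
rewrite (_ : x + 1 = a.+1%:Z + (x - a%:Z)); last by lia.
by rewrite (qnum_add a.+1%:Z (x - a%:Z)) opprB; ring.
Qed.

(** The range [N] only has to exceed [k], as the terms with a > k vanish; later it is the common
    bound for nilpotency. *)
Definition qalt (N k : nat) (s : int) : R :=
  \sum_(a < N) (-1) ^+ a * qbin k%:Z a * q ^ (a%:Z * s).

Lemma qaltS N k s : (k.+1 < N)%N ->
  qalt N k.+1 s = (1 - q ^ (s - k%:Z)) * qalt N k (s + 1).
Proof.
case: N => // N kN; rewrite mulrBl mul1r {1 2}/qalt !big_ord_recl /= !qbin0.
rewrite -addrA; congr (_ * _ * _ + _); rewrite ?mul0r //.
(* The last term of the second sum vanishes; without it, that sum matches the first one shifted by
   one. *)
rewrite /qalt big_ord_recr /= qbin_small; last by lia.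
rewrite mulr0 mul0r addr0 mulr_sumr -sumrB; apply: eq_bigr => i _.
rewrite /bump /= !add1n (_ : k.+1%:Z = k%:Z + 1); last by lia.
rewrite qpascal exprS.
rewrite (_ : i.+1%:Z * (s + 1) = i.+1%:Z * s + i.+1%:Z); last by lia.
rewrite (_ : i%:Z * (s + 1) = i.+1%:Z * s + (i%:Z - s)); last by lia.
rewrite (_ : i%:Z - k%:Z = (s - k%:Z) + (i%:Z - s)); last by lia.
by rewrite !expqD; ring.
Qed.

(** Gauss's q-binomial theorem: the q-Pascal rule splits off one factor at a time. *)
Lemma qaltE N k s : (k < N)%N ->
  qalt N k s = \prod_(j < k) (1 - q ^ (s + k%:Z - 1 - (j.*2)%:Z)).
Proof.
elim: k s => [|k IH] s kN.
  case: N kN => // N _; rewrite big_ord0 /qalt big_ord_recl /= qbin0 big1.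
    by rewrite addr0 mul0r !mulr1.
  by move=> i _; rewrite qbin_small // mulr0 mul0r.
rewrite qaltS // IH ?(ltnW kN) // big_ord_recr /= mulrC; congr (_ * (1 - q ^ _)).
  by apply: eq_bigr => j _; congr (1 - q ^ _); lia.
by lia.
Qed.

(** The roots of the Gauss product in s are k-1, k-3, ..., 1-k. *)
Lemma qalt_eq0 N k (j : nat) : (k < N)%N -> (j < k)%N ->
  qalt N k (k%:Z - 1 - j.*2%:Z) = 0.
Proof.
move=> kN jk; rewrite qaltE // (bigD1 (Ordinal (ltac:(lia) : (k - 1 - j < k)%N)))
  //=.
rewrite (_ : k%:Z - 1 - j.*2%:Z + k%:Z - 1 - _ = 0); last by lia.
by rewrite expr0z subrr mul0r.
Qed.

(** The exponent k + 1 is the first one of the right parity beyond the roots. *)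
Lemma qalt_top N k : (k < N)%N ->
  qalt N k (k%:Z + 1) = (-1) ^+ k * (q - q^-1) ^+ k * qfac k *
    \prod_(j < k) q ^ (j%:Z + 1).
Proof.
move=> kN; rewrite qaltE // (reindex_inj rev_ord_inj) /=.
have -> : \prod_(j < k) (1 - q ^ (k%:Z + 1 + k%:Z - 1 - (k - j.+1).*2%:Z)) =
   \prod_(j < k) (1 - q ^ ((j%:Z + 1) + (j%:Z + 1))).
  by apply: eq_bigr => j _; congr (1 - q ^ _); have := ltn_ord j; lia.
elim: k {kN} => [|k IH]; first by rewrite !big_ord0 /qfac /= !mulr1.
rewrite !big_ord_recr /= IH qfacS !exprS !qnumE expqN (_ : k.+1%:Z = k%:Z + 1);
  last by lia.
rewrite (expqD (k%:Z + 1) (k%:Z + 1)).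
have := expq_neq0 (k%:Z + 1); have := subqV_neq0.
move: (\prod_(_ < _) _) (q ^ _) (q - _) => P x d d0 x0.
by field; rewrite x0 d0.
Qed.

(* Sums against [a |-> q^(a s) [p + a][p + a - 1]...[p + a - d + 1]]: expanding
   one quantum integer at a time shifts [s] by one, so only the values of
   [qalt] at the exponents s + d, s + d - 2, ..., s - d matter. *)
Definition qfsum (N k : nat) (p : int) (s : int) (d : nat) : R :=
  \sum_(a < N) (-1) ^+ a * qbin k%:Z a * q ^ (a%:Z * s) * qfall (p + a%:Z) d.

Lemma qfsum0 N k p s : qfsum N k p s 0 = qalt N k s.
Proof. by apply: eq_bigr => a _; rewrite /= mulr1. Qed.

Lemma qfsumS N k p s d : qfsum N k p s d.+1 =
  (q ^ (p - d%:Z) * qfsum N k p (s + 1) d -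
   q ^ (d%:Z - p) * qfsum N k p (s - 1) d) / (q - q^-1).
Proof.
rewrite /qfsum !mulr_sumr -sumrB mulr_suml; apply: eq_bigr => a _ /=.
rewrite {1}qnumE (_ : p + a%:Z - d%:Z = (p - d%:Z) + a%:Z); last by lia.
rewrite (_ : a%:Z * (s + 1) = a%:Z * s + a%:Z); last by lia.
rewrite (_ : a%:Z * (s - 1) = a%:Z * s + (- a%:Z)); last by lia.
rewrite (_ : - (p - d%:Z + a%:Z) = (d%:Z - p) + (- a%:Z)); last by lia.
by rewrite !expqD; ring.
Qed.

(** The expansion reaches the exponents k-1-2j, ..., k-1-2(j+d), which are all roots of [qalt]. *)
Lemma qfsum_eq0 N k p d (j : nat) : (k < N)%N -> (j + d < k)%N ->
  qfsum N k p (k%:Z - 1 - j.*2%:Z - d%:Z) d = 0.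
Proof.
move=> kN; elim: d j => [|d IH] j jk.
  by rewrite subr0 qfsum0 qalt_eq0 //; lia.
rewrite qfsumS (_ : _ + 1 = k%:Z - 1 - j.*2%:Z - d%:Z); last by lia.
rewrite IH; last by lia.
rewrite (_ : _ - 1 = k%:Z - 1 - j.+1.*2%:Z - d%:Z); last by lia.
by rewrite IH ?mulr0 ?subrr ?mul0r //; lia.
Qed.

(** Here s + d = k + 1 and all lower exponents are roots, so only the leading power q^(p-j) of each
    quantum integer contributes. *)
Lemma qfsum_top N k (p : int) d : (k < N)%N -> (d <= k)%N ->
  qfsum N k p (k%:Z + 1 - d%:Z) d =
    (-1) ^+ k * qfac k * (q - q^-1) ^+ (k - d) * 
    (\prod_(j < d) q ^ (p - j%:Z)) * \prod_(j < k) q ^ (j%:Z + 1).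
Proof.
move=> kN; elim: d => [|d IH] dk.
  by rewrite subr0 qfsum0 qalt_top // big_ord0 subn0; ring.
rewrite qfsumS (_ : _ - _ + 1 = k%:Z + 1 - d%:Z); last by lia.
rewrite IH; last by lia.
rewrite (_ : _ - 1 = k%:Z - 1 - 0.*2%:Z - d%:Z); last by lia.
rewrite qfsum_eq0 // mulr0 subr0 big_ord_recr /=.
rewrite (_ : (k - d)%N = (k - d.+1).+1); last by lia.
rewrite exprS; have := subqV_neq0; move: (q - q^-1) => x x0.
by move: (q ^ _) (qfac _) (\prod_(_ < _) _) (\prod_(_ < _) _) => A B C D; field.
Qed.

Lemma qbin_sum N k (p : int) : (k < N)%N ->
  \sum_(a < N) (-1) ^+ a * qbin k%:Z a * q ^ a%:Z * qbin (p + a%:Z) k =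
    (-1) ^+ k * q ^ (k%:Z * (p + 1)).
Proof.
move=> kN; transitivity (qfsum N k p (k%:Z + 1 - k%:Z) k / qfac k).
  rewrite /qfsum mulr_suml; apply: eq_bigr => a _.
  by rewrite (qbinE (p + _)) (_ : _ * (_ - _) = a%:Z) ?mulrA //; lia.
rewrite qfsum_top // subnn expr0 mulr1 -mulrA -big_split /=.
rewrite (eq_bigr (fun=> q ^ (p + 1))); last by move=> j _; rewrite -expqD;
  congr (q ^ _); lia.
rewrite big_const_ord iter_mulr_1 (exprnP (q ^ (p + 1))) exprz_exp (mulrC (p + 1)).
by have := qfac_neq0 k; move: (qfac k) => f f0; field.
Qed.

(** For c > 0 the exponents run from 1 - c + (k - c), which is at most k - 1, down to 1 - k, so all
    of them are roots. *)
Lemma qbin_sum0 N k (p : int) c : (k < N)%N -> (0 < c <= k)%N ->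
  \sum_(a < N) (-1) ^+ a * qbin k%:Z a * q ^ (a%:Z * (1 - c%:Z)) * 
     qbin (p + a%:Z) (k - c) = 0.
Proof.
move=> kN ck; transitivity (qfsum N k p (1 - c%:Z) (k - c) / qfac (k - c)).
  by rewrite /qfsum mulr_suml; apply: eq_bigr => a _; rewrite (qbinE (p + _)) mulrA.
rewrite (_ : 1 - c%:Z = k%:Z - 1 - (c.-1).*2%:Z - (k - c)%N%:Z); last by lia.
by rewrite qfsum_eq0 ?mul0r //; lia.
Qed.

(** * Rank one and rank two *)

Section Sl2Modules.
Variable M : lmodType R.


(** Weight spaces are predicates, linked to [M] only by an induction principle. They can thus be
    eigenspaces of K_i, and exchanging E and F is just a change of arguments. *)
Record sl2_module (N : nat) (wt : int -> M -> Prop) (E F : {linear M -> M}) :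
  Prop := Sl2Module {
  wt0 : forall n, wt n 0;
  wtD : forall n x y, wt n x -> wt n y -> wt n (x + y);
  wtZ : forall n a x, wt n x -> wt n (a *: x);
  wtE : forall n x, wt n x -> wt (n + 2) (E x);
  wtF : forall n x, wt n x -> wt (n - 2) (F x);
  sl2_comm : forall n x, wt n x -> E (F x) - F (E x) = qnum n *: x;
  nilE : forall x, iter N E x = 0;
  nilF : forall x, iter N F x = 0;
  wt_ind : forall P : M -> Prop, P 0 -> (forall x y, P x -> P y -> P (x + y)) ->
    (forall n x, wt n x -> P x) -> forall x, P x }.

Lemma sl2_twist N wt E F : sl2_module N wt E F ->
  sl2_module N (fun n => wt (- n)) F E.
Proof.
case=> w0 wD wZ wE wF c nE nF wi; split=> //=.
- by move=> n x y; exact: wD.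
- by move=> n a x; exact: wZ.
- by move=> n x h; rewrite opprD; exact: wF.
- by move=> n x h; rewrite opprB addrC; exact: wE.
- by move=> n x wx; rewrite -[LHS]opprB (c _ _ wx) qnumN scaleNr opprK.
- by move=> P P0 PD Pw; apply: wi => // n x; rewrite -[n]opprK; exact: Pw.
Qed.

Definition divp (G : M -> M) (k : nat) (x : M) : M :=
  locked ((qfac k)^-1 *: iter k G x).

Lemma divpE G k x : divp G k x = (qfac k)^-1 *: iter k G x.
Proof. by rewrite /divp -lock. Qed.

Lemma divp0 (G : M -> M) x : divp G 0 x = x.
Proof. by rewrite !divpE /qfac /= invr1 scale1r. Qed.

Lemma divp_linear (G : {linear M -> M}) k : linear (divp G k).
Proof.
move=> a x y; rewrite !divpE.
have -> : iter k G (a *: x + y) = a *: iter k G x + iter k G y.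
  by elim: k => //= k ->; rewrite linearP.
by rewrite scalerDr !scalerA mulrC.
Qed.
HB.instance Definition _ (G : {linear M -> M}) k :=
  GRing.isLinear.Build R M M _ (divp G k) (divp_linear G k).

Lemma divpS (G : {linear M -> M}) k x :
  G (divp G k x) = qnum k.+1%:Z *: divp G k.+1 x.
Proof.
rewrite !divpE qfacS.
rewrite linearZ_LR scalerA invfM mulVKf //.
exact: qnum_neq0.
Qed.

Lemma divpSE (G : {linear M -> M}) k x :
  divp G k.+1 x = (qnum k.+1%:Z)^-1 *: G (divp G k x).
Proof. by rewrite divpS scalerA mulVf ?scale1r // qnum_neq0. Qed.

Lemma divpSr (G : {linear M -> M}) k x :
  divp G k (G x) = qnum k.+1%:Z *: divp G k.+1 x.
Proof.
rewrite !divpE qfacS scalerA invfM mulVKf; last exact: qnum_neq0.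
by rewrite iterSr.
Qed.

Lemma divp_add (G : {linear M -> M}) b d x :
  divp G b (divp G d x) = qbin (b + d)%N%:Z d *: divp G (b + d) x.
Proof.
elim: b => [|b IH]; first by rewrite divp0 qbinn // scale1r.
by rewrite addSn divpSE IH linearZ_LR divpS 2!scalerA qbin_top.
Qed.

Section Strings.
Variables (N : nat) (wt : int -> M -> Prop) (E F : {linear M -> M}).
Hypothesis sl2 : sl2_module N wt E F.

Definition highest (n : int) (v : M) : Prop := wt n v /\ E v = 0.

Lemma wt_divpF n v k : wt n v -> wt (n - k.*2%:Z) (divp F k v).
Proof.
move=> wv; elim: k => [|k IH]; first by rewrite divp0 subr0.
rewrite divpSE; apply/(wtZ sl2); have := wtF sl2 IH.
by rewrite (_ : _ - 2 = n - k.+1.*2%:Z) //; lia.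
Qed.

Lemma E_divpF n v k : highest n v ->
  E (divp F k.+1 v) = qnum (n - k%:Z) *: divp F k v.
Proof.
case=> wv Ev; elim: k => [|k IH].
  have := sl2_comm sl2 wv; rewrite Ev raddf0 subr0 divpSE divp0 => h.
  by rewrite linearZ_LR h qnum1 // invr1 scale1r subr0.
rewrite divpSE linearZ_LR; have := sl2_comm sl2 (wt_divpF k.+1 wv).
move/(canRL (subrK _)) ->; rewrite IH linearZ_LR divpS scalerA -scalerDl scalerA.
congr (_ *: _); have k0 := @qnum_neq0 k.+2%:Z isT.
apply: (mulfI k0); rewrite mulVKf //.
rewrite (_ : n - k.+1.*2%:Z = (n - k.+1%:Z) - k.+1%:Z); last by lia.
rewrite (_ : n - k%:Z = (n - k.+1%:Z) + 1); last by lia.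
by rewrite qnum_rel (_ : k.+2%:Z = k.+1%:Z + 1) //; lia.
Qed.

Lemma divpE_divpF n v x a : highest n v ->
  divp E a (divp F (x + a) v) = qbin (n - x%:Z) a *: divp F x v.
Proof.
move=> hv; elim: a x => [|a IH] x; first by rewrite addn0 divp0 qbin0 scale1r.
rewrite -addSnnS divpSE IH linearZ_LR (E_divpF _ hv) !scalerA; congr (_ *: _).
have a0 := @qnum_neq0 a.+1%:Z isT.
apply: (mulfI a0); rewrite -mulrA mulVKf //.
by rewrite (_ : n - x%:Z = n - x.+1%:Z + 1) ?qbinSS 1?mulrC //; lia.
Qed.

Lemma divpE_small n v k a : highest n v -> (k < a)%N -> divp E a (divp F k v) = 0.
Proof.
move=> hv; elim: a => // a IH; rewrite ltnS leq_eqVlt => /orP[/eqP->|/IH h].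
  by rewrite divpSE -[X in divp F X](add0n a) (divpE_divpF _ _ hv) divp0
    linearZ_LR hv.2 !scaler0.
by rewrite divpSE h raddf0 scaler0.
Qed.

Lemma divpF_eq0 n v k : highest n v -> (forall j, (j < k)%N -> n != j%:Z) ->
  divp F k v = 0 -> v = 0.
Proof.
move=> hv; elim: k => [_|k IH nk h]; first by rewrite divp0.
apply: IH => [j jk|]; first by apply: nk; exact: ltnW.
have := E_divpF k hv; rewrite h raddf0 => /esym/eqP.
rewrite scaler_eq0 => /orP[|/eqP //].
have /negbTE -> // : qnum (n - k%:Z) != 0.
by apply: qnum_neq0; have := nk k (ltnSn k); lia.
Qed.

(** If n is not in {0, ..., N-1}, no scalar [n-k] in the formula of [E_divpF] with k < N is zero,
    and F^(N) v = 0 forces v = 0. *)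
Lemma highest_nat n v : highest n v -> v != 0 ->
  exists2 p : nat, n = p%:Z & (p < N)%N.
Proof.
move=> hv v0; have nF : divp F N v = 0 by rewrite !divpE (nilF sl2) scaler0.
have [/existsP[p /eqP ->]|/existsPn np] := boolP [exists p : 'I_N, n == p%:Z].
  by exists p.
case/negP: v0; apply/eqP/(divpF_eq0 hv _ nF) => j jN; apply/negP => nj.
by have /negP := np (Ordinal jN).
Qed.

(** F^(p+1) v is again killed by E and has weight -p-2, so it vanishes by [highest_nat]. *)
Lemma divpF_highest (p : nat) v k : highest p%:Z v -> (p < k)%N -> divp F k v = 0.
Proof.
move=> hv; elim: k => // k IH; rewrite ltnS leq_eqVlt => /orP[/eqP<-|/IH h].
  apply/eqP/negPn/negP => h0; case: (@highest_nat (p%:Z - p.+1.*2%:Z) _ _ h0).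
    by split; [exact: wt_divpF hv.1|rewrite (E_divpF _ hv) subrr qnum0 scale0r].
  by move=> x; lia.
by rewrite divpSE h raddf0 scaler0.
Qed.

(** With the highest weight written as p + k, the numbers k and p count the steps above and below
    F^(k) v in its string. *)
Inductive strings (w : int) : M -> Prop :=
  | strings0 : strings w 0
  | strings_add (p k : nat) v x : highest (p + k)%N%:Z v ->
      w = p%:Z - k%:Z -> strings w x -> strings w (divp F k v + x).

(** A weight w + 2 >= 1 forces p > 0, so [p] is invertible, and E sends F^(k+1) v to [p] F^(k) v. *)
Lemma strings_lift w x : -1 <= w -> strings (w + 2) x ->
  exists2 y, strings w y & E y = x.
Proof.
move=> w0; elim=> [|p k v {}x hv we _ [y sy <-]].
  by exists 0; [exact: strings0|exact: raddf0].
case: p hv we => [|p] hv we; first by lia.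
have p0 : qnum p.+1%:Z != 0 by exact: qnum_neq0.
exists (divp F k.+1 ((qnum p.+1%:Z)^-1 *: v) + y).
  apply: (@strings_add _ p) => //; last by lia.
  by rewrite addnS -addSn; split;
    [exact/(wtZ sl2)/hv.1|rewrite linearZ_LR hv.2 scaler0].
rewrite linearD; congr (_ + _); rewrite linearZ_LR linearZ_LR (E_divpF _ hv).
by rewrite PoszD addrK scalerA mulVf // scale1r.
Qed.

Lemma strings_wt w x : strings w x -> wt w x.
Proof.
elim=> [|p k v {}x hv -> _ wx]; first exact: wt0 sl2 _.
apply: (wtD sl2) wx; have := wt_divpF k hv.1.
by rewrite (_ : _ - _ = p%:Z - k%:Z) //; lia.
Qed.

(** Induction on the power of E that kills x: E x lifts to a sum of strings y, and x - y is then a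
    highest weight vector. *)
Lemma strings_ge0 w x : 0 <= w -> wt w x -> strings w x.
Proof.
have := nilE sl2 x; elim: {1}N w x => [|n IH] w x /=.
  by move=> ->; constructor.
rewrite -iterS iterSr => nx w0 wx.
have [y sy Ey] : exists2 y, strings w y & E y = E x.
  by apply: strings_lift; [lia|apply: IH nx _ (wtE sl2 wx); lia].
have hxy : highest w (x - y).
  split; last by rewrite raddfB /= Ey subrr.
  by apply: (wtD sl2 wx); rewrite -scaleN1r; exact/(wtZ sl2)/strings_wt.
case: w w0 hxy {wx} sy => // p _ hxy sy.
rewrite -[x](subrK y) -[x - y](divp0 F).
by apply: (strings_add (p := p)) => //; rewrite ?addn0 ?subr0.
Qed.

End Strings.

(** A string can be read from either end. Divided powers make the change of reading free of scalars,
    as the coefficient is a binomial [n-k choose n-k]. *)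
Lemma lowest_highest N wt E F (n : nat) u : sl2_module N wt E F ->
  highest (fun n => wt (- n)) F n u ->
  highest wt E n (divp E n u) /\
  forall k, (k <= n)%N -> divp E k u = divp F (n - k) (divp E n u).
Proof.
move=> sl2 hu; have sl2' := sl2_twist sl2; split; last first.
  move=> k kn; have := divpE_divpF sl2' k (n - k) hu; rewrite subnKC // => ->.
  by rewrite (_ : n%:Z - k%:Z = (n - k)%N%:Z) ?qbinn ?scale1r //; lia.
split; last by rewrite divpS (divpF_highest sl2' hu) // scaler0.
have := wt_divpF sl2' n hu.1; rewrite (_ : - _ = n%:Z) //; lia.
Qed.

(** For w < 0, [strings_ge0] applies after exchanging E and F, and the strings obtained are read
    backwards. *)
Lemma string_wt_ind N wt E F w : sl2_module N wt E F -> forall P : M -> Prop,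
  P 0 -> (forall x y, P x -> P y -> P (x + y)) ->
  (forall (p k : nat) v, highest wt E (p + k)%N%:Z v -> w = p%:Z - k%:Z ->
    P (divp F k v)) ->
  forall x, wt w x -> P x.
Proof.
move=> sl2 P P0 PD Ps x wx; have [w0|w0] := boolP (0 <= w).
  by elim: (strings_ge0 sl2 w0 wx) => // p k v y hv wE _ Py; apply: PD Py;
    exact: Ps hv wE.
have sl2' := sl2_twist sl2.
have wx' : wt (- - w) x by rewrite opprK.
have w0' : 0 <= - w by lia.
elim: (strings_ge0 sl2' w0' wx') => // p k v y hv wE _ Py; apply: PD Py.
have [hu ->] := lowest_highest sl2 hv; last by lia.
by rewrite addnK; apply: (Ps k) => //; [rewrite addnC|lia].
Qed.

Lemma string_ind N wt E F : sl2_module N wt E F -> forall P : M -> Prop,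
  P 0 -> (forall x y, P x -> P y -> P (x + y)) ->
  (forall (p k : nat) v, highest wt E (p + k)%N%:Z v -> P (divp F k v)) ->
  forall x, P x.
Proof.
move=> sl2 P P0 PD Ps; apply: (wt_ind sl2) => // n x.
by apply: (string_wt_ind sl2) => // p k v hv _; exact: Ps hv.
Qed.

(** Negative powers are 0, so that b = n + a + c, the solution of -a + b - c = n, needs no side
    condition. *)
Definition divpz (G : M -> M) (b : int) (x : M) : M :=
  if b is Posz b' then divp G b' x else 0.

Definition braid_term (E F : M -> M) (n : int) (a c : nat) (x : M) : M :=
  ((-1) ^ (n + a%:Z + c%:Z) * q ^ (n + a%:Z + c%:Z - (a * c)%N%:Z)) *:
    divp E a (divpz F (n + a%:Z + c%:Z) (divp E c x)).

Definition braid_op (N : nat) (wt : int -> M -> Prop) (E F T : M -> M) : Prop :=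
  forall n x, wt n x -> T x = \sum_(a < N) \sum_(c < N) braid_term E F n a c x.

Lemma braid_term_string N wt E F (p k a c : nat) v : sl2_module N wt E F ->
  highest wt E (p + k)%N%:Z v ->
  braid_term E F (p%:Z - k%:Z) a c (divp F k v) =
  (if (c <= k)%N then (-1) ^ (p%:Z - k%:Z + c%:Z) * q ^ (p%:Z - k%:Z + c%:Z) *
     qbin (p%:Z + c%:Z) c * ((-1) ^+ a * qbin k%:Z a *
      q ^ (a%:Z * (1 - c%:Z)) * qbin (p%:Z + a%:Z) (k - c)) else 0) *: divp F p v.
Proof.
move=> sl2 hv; rewrite /braid_term; set b := p%:Z - k%:Z + a%:Z + c%:Z.
case: leqP => ck; last first.
  by rewrite (divpE_small sl2 hv) //; case: b => [b|b] /=; rewrite !raddf0 scale0r.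
have -> : divp F k v = divp F (k - c + c) v by rewrite subnK.
rewrite (divpE_divpF sl2 _ _ hv).
rewrite (_ : (p + k)%N%:Z - (k - c)%N%:Z = p%:Z + c%:Z); last by lia.
have -> x : divpz F b (x *: divp F (k - c) v) =
    (x * qbin (p%:Z + a%:Z) (k - c)) *: divp F (p + a) v.
  have [bE|bE] : (exists b' : nat, b = b'%:Z) \/ (exists b' : nat, b = - b'.+1%:Z).
    by case: (b) => b'; [left; exists b'|right; exists b'; rewrite NegzE].
  - case: bE => b' bE; rewrite bE /= linearZ_LR /= divp_add scalerA.
    by congr ((_ * qbin _ _) *: divp F _ _); lia.
  (* A negative b means p + a < k - c, so the binomial vanishes as well. *)
  - case: bE => b' bE; rewrite bE -NegzE /=.
    by rewrite -PoszD qbin_small ?mulr0 ?scale0r //; lia.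
rewrite linearZ_LR /= (divpE_divpF sl2 _ _ hv).
rewrite (_ : (p + k)%N%:Z - p%:Z = k%:Z); last by lia.
rewrite !scalerA; congr (_ *: _).
have -> : b = (p%:Z - k%:Z + c%:Z) + a%:Z by rewrite /b; lia.
rewrite (_ : _ - (a * c)%N%:Z = (p%:Z - k%:Z + c%:Z) + (a%:Z * (1 - c%:Z)));
  last by lia.
move: (p%:Z - k%:Z + c%:Z) (a%:Z * (1 - c%:Z)) => u w.
rewrite (expqD u w) (expfzDr u a%:Z) ?oppr_eq0 ?oner_eq0 // exprnP; ring.
Qed.

(* In the triple sum for T (F^(k) v) the sum over a vanishes unless c = 0, by
   the q-binomial theorem. *)
Lemma braid_string N wt E F (T : {linear M -> M}) (p k : nat) v :
  sl2_module N wt E F -> braid_op N wt E F T -> highest wt E (p + k)%N%:Z v ->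
  T (divp F k v) = ((-1) ^+ p * q ^ (p%:Z * (k%:Z + 1))) *: divp F p v.
Proof.
move=> sl2 TE hv; have [->|v0] := eqVneq v 0; first by rewrite !raddf0.
(* The range a < N has to contain the whole q-binomial sum. *)
have kN : (k < N)%N.
  by have [n /eqP] := highest_nat sl2 hv v0; rewrite eqz_nat => /eqP <-; lia.
have wx : wt (p%:Z - k%:Z) (divp F k v).
  by have := wt_divpF sl2 k hv.1; rewrite (_ : _ - _ = p%:Z - k%:Z) //; lia.
rewrite (TE _ _ wx) exchange_big /=.
rewrite (eq_bigr (fun c : 'I_N => ((c == 0 :> nat)%:R *
    ((-1) ^+ p * q ^ (p%:Z * (k%:Z + 1)))) *: divp F p v)) => [|c _].
  case: N kN {sl2 TE} => // N _; rewrite big_ord_recl /= mul1r big1 ?addr0 //.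
  by move=> i _; rewrite mul0r scale0r.
rewrite (eq_bigr _ (fun a _ => braid_term_string _ _ sl2 hv)) -scaler_suml.
congr (_ *: _); case: leqP => ck; last first.
  by rewrite big1 // (_ : (c == 0 :> nat) = false) ?mul0r //; lia.
rewrite -mulr_sumr; have [c0|c0] := eqVneq (c : nat) 0.
  rewrite c0 subn0 subr0 !addr0 qbin0 mulr1 mul1r.
  under eq_bigr do rewrite mulr1.
  rewrite qbin_sum // !exprnP mulrACA -expqD -expfzDr ?oppr_eq0 ?oner_eq0 //.
  by congr ((-1) ^ _ * q ^ _); lia.
by rewrite qbin_sum0 ?mulr0 ?mul0r //; lia.
Qed.

(* [t = 1] for the braid operator; the same operator satisfies this with
   [t = (-q)^-1] once the roles of E and F are exchanged. *)
Definition string_op (wt : int -> M -> Prop) (E F : {linear M -> M}) (t : R)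
  (T : M -> M) : Prop := forall (p k : nat) v, highest wt E (p + k)%N%:Z v ->
  T (divp F k v) =
    (t ^ (p%:Z - k%:Z) * (-1) ^+ p * q ^ (p%:Z * (k%:Z + 1))) *: divp F p v.

Lemma string_op_braid N wt E F (T : {linear M -> M}) : sl2_module N wt E F ->
  braid_op N wt E F T -> string_op wt E F 1 T.
Proof.
by move=> sl2 TE p k v hv; rewrite (braid_string sl2 TE hv) exp1rz mul1r.
Qed.

Section RankOne.
Variables (N : nat) (wt : int -> M -> Prop) (E F T : {linear M -> M}) (t : R).
Hypothesis sl2 : sl2_module N wt E F.
Hypothesis t_neq0 : t != 0.
Hypothesis TE : string_op wt E F t T.

Lemma braid_wtN n x : wt n x -> wt (- n) (T x).
Proof.
move: x; apply: (string_wt_ind sl2) => [|y z wy wz|p k v hv ->].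
- by rewrite raddf0; exact: wt0 sl2 _.
- by rewrite raddfD; exact: wtD sl2 _ _ _ _ _.
rewrite (TE hv); apply: (wtZ sl2); have := wt_divpF sl2 p hv.1.
by rewrite (_ : _ - _ = - (p%:Z - k%:Z)) //; lia.
Qed.

Lemma braid_surj x : exists y, T y = x.
Proof.
move: x; apply: (string_ind sl2) => [|x y [x' <-] [y' <-]|p k v hv].
- by exists 0; rewrite raddf0.
- by exists (x' + y'); rewrite raddfD.
rewrite addnC in hv; have := TE hv; set c := (_ * _) => Th.
have c0 : c != 0.
  by rewrite /c !mulf_neq0 ?expq_neq0 ?expfz_neq0 // signr_eq0.
by exists (c^-1 *: divp F p v); rewrite linearZ_LR Th scalerA mulVf // scale1r.
Qed.

(** Passing from (p, k) to (p + 1, k - 1) changes the exponent of t by 2, that of q by k - p = -n,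
    and the sign. *)
Lemma braid_E n x : wt n x -> T (E x) = - (t ^+ 2 * q ^ (- n)) *: F (T x).
Proof.
move: x; apply: (string_wt_ind sl2) => [|y z hy hz|p k v hv ->];
  first by rewrite !raddf0.
  by rewrite !raddfD /= hy hz.
rewrite (TE hv) linearZ_LR /= divpS.
case: k hv => [|k] hv.
  rewrite divp0 hv.2 raddf0 (divpF_highest sl2 (p := p)) ?scaler0 //.
  by rewrite addn0 in hv.
rewrite (E_divpF sl2 _ hv) linearZ_LR /= (_ : (p + k.+1)%N%:Z - k%:Z = p.+1%:Z);
  last by lia.
rewrite addnS -addSn in hv; rewrite (TE hv) !scalerA; congr (_ *: _).
rewrite (_ : p.+1%:Z * (k%:Z + 1) = - (p%:Z - k.+1%:Z) + p%:Z * (k.+1%:Z + 1));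
  last by lia.
rewrite (_ : p.+1%:Z - k%:Z = 1 + 1 + (p%:Z - k.+1%:Z)); last by lia.
by rewrite expqD exprS !(expfzDr _ _ t_neq0) expr1z; ring.
Qed.

End RankOne.

(** * Rank two: an operator [X] standing for a neighbouring E_j, or F_j after the exchange of E and
    F *)

Section RankTwo.
Variables (N : nat) (wt : int -> M -> Prop) (E F X T : {linear M -> M}) (t : R).
Hypothesis sl2 : sl2_module N wt E F.
Hypothesis t_neq0 : t != 0.
Hypothesis TE : string_op wt E F t T.
Hypothesis XF : forall x, X (F x) = F (X x).
Hypothesis Xwt : forall n x, wt n x -> wt (n - 1) (X x).
Hypothesis serre : forall x,
  E (E (X x)) + X (E (E x)) = (q + q^-1) *: E (X (E x)).

Lemma X_divpF k x : X (divp F k x) = divp F k (X x).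
Proof.
elim: k => [|k IH]; first by rewrite !divp0.
by rewrite !divpSE linearZ_LR /= XF IH.
Qed.

(* X v = w0 + c F x1, where w0 and x1 = E X v are highest weight vectors for
   the weights n - 1 and n + 1. *)
Lemma X_highest n v : highest wt E n v -> qnum (n + 1) != 0 ->
  exists w0 : M, exists x1 : M,
  [/\ highest wt E (n - 1) w0, highest wt E (n + 1) x1
    & forall k, X (divp F k v) =
        divp F k w0 + (qnum k.+1%:Z / qnum (n + 1)) *: divp F k.+1 x1].
Proof.
move=> [wv Ev] n0; have wX := Xwt wv.
have wx1 : wt (n + 1) (E (X v)).
  by have := wtE sl2 wX; rewrite (_ : n - 1 + 2 = n + 1) //; lia.
have Ex1 : E (E (X v)) = 0.
  by have := serre v; rewrite Ev !raddf0 addr0.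
exists (X v - (qnum (n + 1))^-1 *: F (E (X v))); exists (E (X v)); split=> //.
- split.
    apply: (wtD sl2) => //; rewrite -scaleN1r; do 2!apply: (wtZ sl2).
    by have := wtF sl2 wx1; rewrite (_ : n + 1 - 2 = n - 1) //; lia.
  rewrite raddfB /= linearZ_LR /=; have := sl2_comm sl2 wx1.
  by rewrite Ex1 raddf0 subr0 => ->; rewrite scalerA mulVf // scale1r subrr.
move=> k; rewrite X_divpF raddfB /= linearZ_LR /= divpSr scalerA.
by rewrite [_^-1 * _]mulrC subrK.
Qed.

(** For t = 1 and X = E_j, conjugation by T_i turns E_j into a q-commutator of E_i and E_j. By
    [X_highest] both sides are combinations of F^(p-1) w0 and F^(p) x1, whose coefficients are
    compared. *)
Lemma braid_X x : T (X x) = t^-1 *: (E (X (T x)) - q^-1 *: X (E (T x))).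
Proof.
move: x; apply: (string_ind sl2) => [|y z hy hz|p k v hv].
- by rewrite !(raddf0, scaler0, subr0).
- by rewrite !raddfD /= hy hz !raddfD /= addrACA.
have n0 : qnum ((p + k)%N%:Z + 1) != 0 by apply: qnum_neq0; lia.
have [w0 [x1 [hw hx Xv]]] := X_highest hv n0.
have Tx1 : T (divp F k.+1 x1) =
    (t ^ (p%:Z - k.+1%:Z) * (-1) ^+ p * q ^ (p%:Z * (k.+1%:Z + 1))) *: divp F p x1.
  by apply: TE; rewrite (_ : (p + k.+1)%N%:Z = (p + k)%N%:Z + 1) //; lia.
(* [D] is F^(p-1) w0, or 0 if p = 0; naming it removes the boundary case from the computation
   below. *)
have [D [TD ED XD]] : exists D : M,
  [/\ T (divp F k w0) = - (t ^ (p%:Z - k.+1%:Z) * (-1) ^+ p *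
        q ^ ((p%:Z - 1) * (k%:Z + 1))) *: D,
      E (divp F p w0) = qnum k%:Z *: D
    & X (E (divp F p v)) = qnum k.+1%:Z *: (D +
        (qnum p%:Z / qnum ((p + k)%N%:Z + 1)) *: divp F p x1)].
  case: p hv n0 hw hx Xv {Tx1} => [|p] hv n0 hw hx Xv.
    (* For p = 0 the weight of w0 is k - 1, so F^(k) w0 = 0; if also k = 0, then w0 = 0 because -1
       is not a highest weight. *)
    exists 0; rewrite !divp0 hw.2 hv.2 qnum0 mul0r scale0r addr0 !scaler0 raddf0.
    split=> //; case: k {Xv n0 hx} hv hw => [|k] hv hw.
      apply/eqP/negPn/negP => w0n; have [||y] := @highest_nat _ _ _ _ sl2 (-1) w0.
      - by [].
      - by apply: contraNneq w0n => ->; rewrite !raddf0.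
      by [].
    rewrite (divpF_highest sl2 (p := k)) ?raddf0 //.
    by rewrite (_ : k%:Z = (0 + k.+1)%N%:Z - 1) //; lia.
  exists (divp F p w0); split.
  - rewrite (TE (p := p));
    last by rewrite (_ : (p + k)%N%:Z = (p.+1 + k)%N%:Z - 1) //; lia.
    rewrite (_ : p%:Z - k%:Z = p.+1%:Z - k.+1%:Z); last by lia.
    by rewrite (_ : p.+1%:Z - 1 = p%:Z) ?exprS; [congr (_ *: _); ring|lia].
  - by rewrite (E_divpF sl2 _ hw); congr (qnum _ *: _); lia.
  - rewrite (E_divpF sl2 _ hv) linearZ_LR /=.
    rewrite Xv.
    rewrite (_ : (p.+1 + k)%N%:Z - p%:Z = k.+1%:Z) //; lia.
have XZ a y : X (a *: y) = a *: X y by rewrite linearZ_LR.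
have EZ a y : E (a *: y) = a *: E y by rewrite linearZ_LR.
have TZ a y : T (a *: y) = a *: T y by rewrite linearZ_LR.
have EA y z : E (y + z) = E y + E z by rewrite raddfD.
have TA y z : T (y + z) = T y + T z by rewrite raddfD.
rewrite (TE hv) !(XZ, EZ) (Xv k) TA TZ TD Tx1 XD.
rewrite (Xv p) EA EZ ED (E_divpF sl2 _ hx).
rewrite (_ : (p + k)%N%:Z + 1 - p%:Z = k.+1%:Z); last by lia.
rewrite -[- (q^-1 *: _)]scaleN1r !(scalerDr, scalerA) addrACA -!scalerDl.
have tE : t ^ (p%:Z - k.+1%:Z) = t^-1 * t ^ (p%:Z - k%:Z).
  by rewrite -exprN1 -expfzDr //; congr (t ^ _); lia.
move: n0; set n := qnum (_ + 1) => n0; congr (_ *: _ + _ *: _).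
  rewrite (_ : p%:Z * (k%:Z + 1) = (p%:Z - 1) * (k%:Z + 1) + k%:Z + 1); last by lia.
  rewrite tE (_ : k.+1%:Z = k%:Z + 1) ?qnumS; last by lia.
  rewrite (expqD _ 1) expr1z (expqD _ k%:Z) expqN.
  have := expq_neq0 k%:Z; move: (q ^ k%:Z) (q ^ _) (qnum _) (t ^ _) => x y z w x0.
  by field; rewrite t_neq0 x0 q_neq0.
rewrite (_ : k.+1%:Z + 1 = k%:Z + 1 + 1); last by lia.
rewrite mulrDr mulr1 expqD tE (_ : p.+1%:Z = p%:Z + 1) ?qnumSV; last by lia.
move: (q ^ p%:Z) (q ^ _) (qnum _) (qnum _) (t ^ _) => x y z u w.
by field; rewrite t_neq0 n0 q_neq0.
Qed.

(** With the roles of E and X exchanged, this is the q-commutator of [braid_X], so that the two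
    lemmas compose to T_i T_j E_i = E_j T_i T_j. It follows from [braid_X] and [braid_E] by moving E
    past F. *)
Lemma braid_X_inv x : T (X (E x) - q^-1 *: E (X x)) = t *: X (T x).
Proof.
move: x; apply: (wt_ind sl2) => [|x y hx hy|n x wx].
- by rewrite !(raddf0, scaler0, subr0).
- have -> : t *: X (T (x + y)) = t *: X (T x) + t *: X (T y) by rewrite !raddfD.
  rewrite -hx -hy -raddfD /=; congr (T _).
  have -> : q^-1 *: E (X (x + y)) =
    q^-1 *: E (X x) + q^-1 *: E (X y) by rewrite !raddfD.
  by rewrite raddfD /= raddfD /= opprD addrACA.
have wz := braid_wtN sl2 t_neq0 TE wx; have wXz := Xwt wz.
have XA y z : X (y - z) = X y - X z by rewrite raddfB.
have XZ a y : X (a *: y) = a *: X y by rewrite linearZ_LR.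
have FA y z : F (y - z) = F y - F z by rewrite raddfB.
have FZ a y : F (a *: y) = a *: F y by rewrite linearZ_LR.
have EZ a y : E (a *: y) = a *: E y by rewrite linearZ_LR.
have TA y z : T (y - z) = T y - T z by rewrite raddfB.
have TZ a y : T (a *: y) = a *: T y by rewrite linearZ_LR.
rewrite TA TZ (braid_E sl2 t_neq0 TE (Xwt wx)) !braid_X (braid_E sl2 t_neq0 TE wx).
rewrite !EZ !XZ !EZ XF FZ FA FZ.
have := sl2_comm sl2 wz => /(canRL (subrK _)) ->.
have := sl2_comm sl2 wXz => /(canRL (subrK _)) ->.
(* Everything is now a combination of three vectors; the coefficient of [y] is t, those of [x1] and
   [x2] vanish. *)
rewrite [X (_ + _)]raddfD /= XZ XF.
set x1 := F (E (X (T x))); set x2 := F (X (E (T x))); set y := X (T x).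
rewrite -![- (_ *: _)]scaleN1r !(scalerDr, scalerA).
rewrite [X in X + _]addrACA -[LHS]addrA [X in _ + X]addrACA -!scalerDl.
have -> : - (n - 1) = - n + 1 by lia.
have -> : - n - 1 = - (n + 1) by lia.
rewrite !qnumN qnumSV expqD expr1z expqN; have := expq_neq0 n.
move: (q ^ n) (qnum n) => u v u0.
rewrite -[RHS]addr0; congr (_ *: _ + _); first by field; rewrite t_neq0 q_neq0 u0.
rewrite -[RHS]addr0; congr (_ + _); apply/eqP; rewrite scaler_eq0; apply/orP;
  left; apply/eqP;
  by field; rewrite t_neq0 q_neq0 u0.
Qed.

End RankTwo.

(** Reading strings from below exchanges p and k. Since k(p+1) - p(k+1) = k - p, the two formulas
    differ by the factor (-q)^(k-p), which gives t = (-q)^-1. *)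
Lemma string_op_twist N wt E F (T : {linear M -> M}) : sl2_module N wt E F ->
  string_op wt E F 1 T -> string_op (fun n => wt (- n)) F E (- q)^-1 T.
Proof.
move=> sl2 TE p k u hu; have [hv uE] := lowest_highest sl2 hu.
have uEk := uE k (leq_addl p k); have uEp := uE p (leq_addr k p).
rewrite addnK in uEk; rewrite addKn in uEp; rewrite uEk uEp.
rewrite (TE k p) 1?addnC //; congr (_ *: _).
rewrite exp1rz mul1r exprz_inv opprB -[- q]mulN1r exprzMl ?unitfE ?oppr_eq0
  ?oner_eq0 //.
have -> : (-1) ^ (k%:Z - p%:Z) = (-1) ^+ k * (-1) ^+ p :> R.
  rewrite expfzDr ?oppr_eq0 ?oner_eq0 //; congr (_ * _).
  by rewrite -invr_expz -exprnP -signr_odd invr_sign.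
rewrite (_ : k%:Z * (p%:Z + 1) = (k%:Z - p%:Z) + p%:Z * (k%:Z + 1)); last by lia.
rewrite (expqD (k%:Z - p%:Z)).
have ss : (-1) ^+ p * (-1) ^+ p = 1 :> R by rewrite -expr2 sqrr_sign.
move: ((-1) ^+ p) ((-1) ^+ k) (q ^ _) (q ^ _) ss => s w x y ss.
by rewrite -[LHS]mulr1 -ss; ring.
Qed.

(** Applied to a far generator, to A = T_i for a far T_j, and to A = T_i T_j for the braid
    relation. *)
Lemma braid_op_comm N wt1 E1 F1 wt2 E2 F2 (T1 T2 A : {linear M -> M}) :
  sl2_module N wt1 E1 F1 -> braid_op N wt1 E1 F1 T1 ->
  braid_op N wt2 E2 F2 T2 ->
  (forall x, A (E1 x) = E2 (A x)) -> (forall x, A (F1 x) = F2 (A x)) ->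
  (forall n x, wt1 n x -> wt2 n (A x)) ->
  forall x, A (T1 x) = T2 (A x).
Proof.
move=> sl2 T1E T2E AE AF Awt.
have Adivp G1 G2 : (forall x, A (G1 x) = G2 (A x)) ->
    forall k x, A (divp G1 k x) = divp G2 k (A x).
  move=> AG k x; rewrite !divpE linearZ_LR /=; congr (_ *: _).
  by elim: k => //= k <-; rewrite AG.
apply: (wt_ind sl2) => [|x y hx hy|n x wx].
- by rewrite !raddf0.
- by rewrite !raddfD /= hx hy.
rewrite (T1E _ _ wx) (T2E _ _ (Awt _ _ wx)) raddf_sum; apply: eq_bigr => a _.
rewrite raddf_sum; apply: eq_bigr => c _.
have AZ d y : A (d *: y) = d *: A y by rewrite linearZ_LR.
rewrite /braid_term /= AZ (Adivp _ _ AE); congr (_ *: divp _ _ _).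
case: (_ + _) => b /=; last by rewrite raddf0.
by rewrite (Adivp _ _ AF) (Adivp _ _ AE).
Qed.

End Sl2Modules.

End QNumbers.

Local Close Scope ring_scope.

(** * Reduced words *)

Section ReducedWords.
Variable m : nat.
Implicit Types (i j k : 'I_m) (u v w : seq 'I_m).

(** Letters act on all natural numbers, fixing those above m, so that positions are handled by plain
    arithmetic. *)
Definition swap (i x : nat) : nat :=
  if x == i then i.+1 else if x == i.+1 then i else x.

Definition wact w (x : nat) : nat := foldr (fun i : 'I_m => swap i) x w.

Lemma wact_rcons w i x : wact (rcons w i) x = wact w (swap i x).
Proof. by rewrite /wact foldr_rcons. Qed.

Lemma swapK i : involutive (swap i).
Proof. by move=> x; rewrite /swap; do ![case: eqP => //]; lia. Qed.

Lemma swap_l i : swap i i = i.+1.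
Proof. by rewrite /swap eqxx. Qed.

Lemma swap_r i : swap i i.+1 = i.
Proof. by rewrite /swap eqxx; case: eqP => //; lia. Qed.

Lemma swap_out (i x : nat) : x != i -> x != i.+1 -> swap i x = x.
Proof. by rewrite /swap => /negbTE -> /negbTE ->. Qed.

Lemma wact_inj w : injective (wact w).
Proof.
elim: w => // i w IH x y /= /(congr1 (swap i)); rewrite -!/(wact _ _) !swapK.
exact: IH.
Qed.

Lemma wact_le w x : (x <= m)%N -> (wact w x <= m)%N.
Proof.
elim: w => //= i w IH /IH; rewrite -/(wact w x) /swap.
by have := ltn_ord i; do ![case: eqP => //]; lia.
Qed.

(* Every letter creates a new inversion; these are exactly the reduced words,
   see [reduced_increasing] and [increasing_reduced]. *)
Inductive increasing_word : seq 'I_m -> Prop :=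
  | increasing_nil : increasing_word [::]
  | increasing_rcons w i : increasing_word w -> (wact w i < wact w i.+1)%N ->
      increasing_word (rcons w i).

Lemma increasing_rconsE w i :
  increasing_word (rcons w i) -> increasing_word w /\ (wact w i < wact w i.+1)%N.
Proof.
move E: (rcons w i) => v h; case: h E => [|{}v j hv lt]; first by case: w.
by move=> /rcons_inj[-> ->].
Qed.

Variables (X : Type) (T : 'I_m -> X -> X).
Hypothesis T_braid : forall i j x, i.+1 = j :> nat ->
  T i (T j (T i x)) = T j (T i (T j x)).
Hypothesis T_comm : forall i j x, (i.+1 < j)%N -> T i (T j x) = T j (T i x).

Definition tact w (x : X) : X := foldr T x w.

Lemma tact_rcons w i x : tact (rcons w i) x = tact w (T i x).
Proof. by rewrite /tact foldr_rcons. Qed.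

(** Only the invariants of braid moves that are used later are recorded, instead of the equivalence
    generated by the moves. *)
Definition similar u v : Prop :=
  [/\ wact u =1 wact v, tact u =1 tact v & size u = size v].

Lemma similar_trans v u w : similar u v -> similar v w -> similar u w.
Proof.
case=> a1 b1 c1 [a2 b2 c2]; split; [|move=> x;
  exact: etrans (b1 x) (b2 x)|exact: etrans c2].
by move=> x; exact: etrans (a1 x) (a2 x).
Qed.

Lemma similar_rcons u v i : similar u v -> similar (rcons u i) (rcons v i).
Proof.
case=> a b c; split=> [x|x|]; first by rewrite !wact_rcons a.
  by rewrite !tact_rcons b.
by rewrite !size_rcons c.
Qed.

Lemma similar_comm u i k : (i.+1 < k)%N || (k.+1 < i)%N ->
  similar (rcons (rcons u i) k) (rcons (rcons u k) i).
Proof.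
move=> ik; split=> [x|x|]; last by rewrite !size_rcons.
  by rewrite !wact_rcons; congr wact; rewrite /swap; do ![case: eqP => //]; lia.
by rewrite !tact_rcons; congr tact; case/orP: ik => h; [|symmetry]; exact: T_comm.
Qed.

Lemma similar_braid u i k : i.+1 = k \/ k.+1 = i ->
  similar (rcons (rcons (rcons u i) k) i) (rcons (rcons (rcons u k) i) k).
Proof.
move=> ik; split=> [x|x|]; last by rewrite !size_rcons.
  by rewrite !wact_rcons; congr wact; rewrite /swap; do ![case: eqP => //]; lia.
by rewrite !tact_rcons; congr tact; case: ik => h; [|symmetry]; exact: T_braid.
Qed.

(* A letter [i] that is a right descent can be moved to the end of the word by
   braid moves; this replaces Matsumoto's theorem below. *)
Lemma exchange w i : increasing_word w -> (wact w i.+1 < wact w i)%N ->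
  exists2 u, increasing_word (rcons u i) & similar w (rcons u i).
Proof.
have [n] := ubnP (size w); elim: n w i => // n IH w i.
case: (lastP w) => [|{}w k]; first by move=> _ _ /=; rewrite /wact /=; lia.
rewrite size_rcons ltnS => wn /increasing_rconsE[iw lk].
rewrite !wact_rcons => li.
have [ki|ki] := eqVneq k i; first by exists w; rewrite ki in lk *;
  [exact: increasing_rcons|].
(* If k and i commute, i is moved to the end of the shorter word and then past k. *)
have [far|near] := boolP ((i.+1 < k)%N || (k.+1 < i)%N).
  rewrite !swap_out in li; try lia.
  have [u /increasing_rconsE[iu lu] wu] := IH _ _ wn iw li.
  exists (rcons u k); last first.
    by apply: similar_trans (similar_rcons k wu) _; exact: similar_comm.
  have [wE _ _] := wu; apply: increasing_rcons; first apply: increasing_rcons => //.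
    by move: lk; rewrite !wE !wact_rcons !swap_out //; lia.
  by rewrite !wact_rcons !swap_out //; lia.
have ik : (i.+1 = k :> nat) \/ (k.+1 = i :> nat).
  by have : k != i :> nat by []; lia.
have sw (a b : nat) : swap a b =
  if b == a then a.+1 else if b == a.+1 then a else b by [].
(* In the adjacent case w has the descent i, and what remains has the descent k. So w k becomes u i
   k, then v k i k, and finally v i k i. *)
have wi : (wact w i.+1 < wact w i)%N.
  case: ik => ik.
    have e1 : swap k i = i by rewrite sw; do ![case: eqP => //]; lia.
    have e2 : swap k i.+1 = k.+1 by rewrite sw; do ![case: eqP => //]; lia.
    by rewrite e1 e2 in li; move: lk li; rewrite ik; lia.
  have e1 : swap k i = k by rewrite sw; do ![case: eqP => //]; lia.
  have e2 : swap k i.+1 = i.+1 by rewrite sw; do ![case: eqP => //]; lia.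
  by rewrite e1 e2 in li; move: lk li; rewrite ik; lia.
have [u /increasing_rconsE[iu lu] wu] := IH _ _ wn iw wi.
have [wE _ sE] := wu; rewrite size_rcons in sE.
have uk : (wact u k.+1 < wact u k)%N.
  move: li lk; rewrite !wE !wact_rcons; case: ik => ik.
    have e1 : swap i (swap k i) = k by rewrite !sw; do ![case: eqP => //]; lia.
    have e2 : swap i (swap k i.+1) = k.+1 by rewrite !sw; do ![case: eqP => //];
      lia.
    by rewrite e1 e2.
  have e1 : swap i (swap k i) = k by rewrite !sw; do ![case: eqP => //]; lia.
  have e2 : swap i (swap k i.+1) = k.+1 by rewrite !sw; do ![case: eqP => //]; lia.
  by rewrite e1 e2.
have [|v /increasing_rconsE[iv lv] uv] := IH _ _ _ iu uk; first by lia.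
have [uE _ _] := uv.
exists (rcons (rcons v i) k); last first.
  apply: similar_trans (similar_rcons k (similar_trans wu (similar_rcons i uv))) _.
  by apply: similar_braid; case: ik; [right|left].
move: li lk lu; rewrite !wE !wact_rcons !uE !wact_rcons => li lk lu.
have swE (a b c : nat) : (if b == a then a.+1 else if b == a.+1 then a else b) =
  c ->
  swap a b = c by [].
(* The ascents that allow i and then k to be appended to v. *)
have [lik lvk] : (wact v i < wact v i.+1)%N /\ (wact v (swap i k) < wact v (swap
  i k.+1))%N.
  move: lk lv; case: ik => ik.
    rewrite (@swE i k i) 1?(@swE k i i) 1?(@swE i k.+1 k.+1) 1?(@swE k k.+1 k);
      try by do ![case: eqP => //]; lia.
    by rewrite -ik; lia.
  rewrite (@swE i k k) 1?(@swE k k k.+1) 1?(@swE i k.+1 i.+1) 1?(@swE k i.+1 i.+1);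
    try by do ![case: eqP => //]; lia.
  by rewrite -ik; lia.
apply: increasing_rcons.
  by apply: increasing_rcons; [exact: increasing_rcons|rewrite !wact_rcons].
have [e1 e2] : swap i (swap k i) = k /\ swap i (swap k i.+1) = k.+1.
  by case: ik => ik; split; rewrite !sw; do ![case: eqP => //]; lia.
by rewrite !wact_rcons e1 e2.
Qed.

(** The last letter of u is a right descent of v; [exchange] moves it to the end of v, and both
    words can be shortened. *)
Lemma increasing_size u v : increasing_word u -> increasing_word v ->
  wact u =1 wact v -> size u = size v.
Proof.
elim/last_ind: u v => [|u i IH] v iu iv uv.
  case: (lastP v) iv uv => // {}v k /increasing_rconsE[_ lt] uv.
  by move: (uv k) (uv k.+1);
    rewrite !wact_rcons swap_l swap_r /wact /= -/(wact v _); move: lt;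
    rewrite /wact; lia.
have [iu' lu] := increasing_rconsE iu.
have lv : (wact v i.+1 < wact v i)%N by rewrite -!uv !wact_rcons swap_l swap_r.
have [v' iv' [vE _ sE]] := exchange iv lv.
have [iv'' _] := increasing_rconsE iv'.
rewrite sE !size_rcons; congr _.+1; apply: IH => // x.
by rewrite -[x](swapK i) -[LHS]wact_rcons -[RHS]wact_rcons uv vE.
Qed.

(* The hypotheses on [wact] say that [w] sends alpha_i to alpha_j. *)
Lemma tact_simple (A : 'I_m -> X -> X) :
  (forall i j x, i.+1 = j :> nat \/ j.+1 = i :> nat ->
     T i (T j (A i x)) = A j (T i (T j x))) ->
  (forall i j x, (i.+1 < j)%N || (j.+1 < i)%N -> T i (A j x) = A j (T i x)) ->
  forall w i j x, increasing_word w -> wact w i = j -> wact w i.+1 = j.+1 ->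
  tact w (A i x) = A j (tact w x).
Proof.
move=> A_adj A_comm w; have [n] := ubnP (size w).
elim: n w => // n IH w wn i j x.
case: (lastP w) wn => [_ _ /= ij _|{}w k]; first by congr A; exact: val_inj.
rewrite size_rcons ltnS => wn /increasing_rconsE[iw lk] /=.
rewrite !wact_rcons => wi wi1.
have sw (a b : nat) : swap a b =
  if b == a then a.+1 else if b == a.+1 then a else b by [].
(* The last letter cannot be i: appending i at an ascent makes the values at i and i + 1 decrease,
   whereas j < j + 1. *)
have [ki|ki] := eqVneq k i.
  by move: wi wi1 lk; rewrite ki swap_l swap_r; lia.
have [far|near] := boolP ((i.+1 < k)%N || (k.+1 < i)%N).
  rewrite !swap_out in wi wi1; try lia.
  by rewrite !tact_rcons A_comm; [exact: IH|rewrite orbC].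
have ik : (i.+1 = k :> nat) \/ (k.+1 = i :> nat).
  by have : k != i :> nat by []; lia.
have inj a b : wact w a = wact w b -> a = b by exact: wact_inj.
(* No value lies strictly between j and j + 1, so the value at the third of the three positions
   involved lies outside them; hence i is a descent of w. *)
have [li e1 e2] : [/\ (wact w i.+1 < wact w i)%N, wact w (swap i k) = j
    & wact w (swap i k.+1) = j.+1].
  case: ik => ik.
    have s1 : swap k i = i by rewrite sw; do ![case: eqP => //]; lia.
    have s2 : swap k i.+1 = k.+1 by rewrite sw; do ![case: eqP => //]; lia.
    have s3 : swap i k = i by rewrite sw; do ![case: eqP => //]; lia.
    have s4 : swap i k.+1 = k.+1 by rewrite sw; do ![case: eqP => //]; lia.
    rewrite s1 in wi; rewrite s2 in wi1; rewrite s3 s4; split=> //.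
    have : wact w k != j by rewrite -wi; apply/eqP => /inj; lia.
    by move: lk; rewrite wi1 ik wi; lia.
  have s1 : swap k i = k by rewrite sw; do ![case: eqP => //]; lia.
  have s2 : swap k i.+1 = i.+1 by rewrite sw; do ![case: eqP => //]; lia.
  have s3 : swap i k = k by rewrite sw; do ![case: eqP => //]; lia.
  have s4 : swap i k.+1 = i.+1 by rewrite sw; do ![case: eqP => //]; lia.
  rewrite s1 in wi; rewrite s2 in wi1; rewrite s3 s4; split=> //.
  have : wact w i != j.+1 by rewrite -wi1; apply/eqP => /inj; lia.
  by move: lk; rewrite ik wi wi1; lia.
have [u /increasing_rconsE[iu _] [uE tE sE]] := exchange iw li.
rewrite size_rcons in sE.
(* T_i T_k carries A_i to A_k, and u is a shorter word sending alpha_k to alpha_j. *)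
rewrite !tact_rcons !tE !tact_rcons A_adj //.
by apply: IH => //; [lia|rewrite -e1 uE wact_rcons swapK|rewrite -e2 uE
  wact_rcons swapK].
Qed.

(* The point of splitting off the letter [i] is that the remaining word
   sends alpha_i to a simple root, so that [tact_simple] applies to it. *)
Lemma longest_split w i j : increasing_word w -> wact w i = j.+1 ->
  wact w i.+1 = j ->
  exists u, [/\ increasing_word u, wact u i = j, wact u i.+1 = j.+1
    & forall x, tact w x = tact u (T i x)].
Proof.
move=> iw wi wi1; have [|u /increasing_rconsE[iu _] [uE tE _]] :=
  exchange iw (i := i).
  by rewrite wi wi1.
exists u; split=> // [||x]; last by rewrite tE tact_rcons.
  by rewrite -wi1 uE wact_rcons swap_r.
by rewrite -wi uE wact_rcons swap_l.
Qed.

End ReducedWords.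

Local Open Scope classical_set_scope.
Local Open Scope ring_scope.

(** * Weight modules *)

Lemma q_neq0 : q != 0.
Proof. by rewrite tofrac_eq0 polyX_eq0. Qed.

Lemma q_nroot (n : nat) : (0 < n)%N -> q ^+ n != 1.
Proof.
move=> n0; rewrite /q -tofracXn -tofrac1 tofrac_eq; apply/eqP.
move=> /(congr1 (fun p : {poly rat} => size p)).
by rewrite size_polyXn size_poly1; case: n n0.
Qed.

Lemma fsum_seq (T : choiceType) (V : zmodType) (s : seq T) (f : T -> V) :
  uniq s -> (forall x, f x != 0 -> x \in s) ->
  \sum_(x \in [set: T]) f x = \sum_(x <- s) f x.
Proof.
move=> us fs; rewrite (@fsbigE _ _ _ _ _ s _ us) //.
  by apply: eq_bigl => x; rewrite in_setT.
by move=> x _ xs; apply/eqP; apply: contraNT xs; exact: fs.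
Qed.

Section Weights.
Variables (r : nat) (M : vectType Qq) (rho : weight_module r M).
Local Notation wt := (Defs.wt rho).
Implicit Types (mu nu : Lam r) (m : M).

Lemma wt_projP m : wt_decomposition wt m (wt_proj rho ^~ m).
Proof. exact: svalP (cid (wt_exists rho m)). Qed.

Lemma wt_proj_in mu m : wt_proj rho mu m \in wt mu.
Proof. by have [+ _ _] := wt_projP m; apply. Qed.

Lemma wt_proj_uniq m f : wt_decomposition wt m f ->
  forall mu, wt_proj rho mu m = f mu.
Proof.
move=> mf mu; have [g [_ gu]] := wt_direct rho m.
by rewrite -[RHS](congr1 (@^~ mu) (gu _ mf)) -[LHS](congr1 (@^~ mu) (gu _
  (wt_projP m))).
Qed.

Lemma wt_decompositionP m f (s : seq (Lam r)) :
  uniq s -> (forall mu, f mu \in wt mu) -> (forall mu, f mu != 0 -> mu \in s) ->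
  m = \sum_(mu <- s) f mu -> forall mu, wt_proj rho mu m = f mu.
Proof.
move=> us fw fs ->; apply: wt_proj_uniq; split=> //;
  last by rewrite (fsum_seq us fs).
by apply: (sub_finite_set _ (finite_seq s)) => mu /= /fs.
Qed.

Lemma wt_proj_supp m : exists s : seq (Lam r),
  [/\ uniq s, forall mu, wt_proj rho mu m != 0 -> mu \in s
    & m = \sum_(mu <- s) wt_proj rho mu m].
Proof.
have [_ fin sumE] := wt_projP m; have [s sE] := (finite_seqP _).1 fin.
have us : forall mu, wt_proj rho mu m != 0 -> mu \in undup s.
  by move=> mu h; rewrite mem_undup; have : [set` s] mu by rewrite -sE.
exists (undup s); split; [exact: undup_uniq|exact: us|].
by rewrite {1}sumE (fsum_seq (undup_uniq s) us).
Qed.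

Lemma wt_proj_wt mu m : m \in wt mu ->
  forall nu, wt_proj rho nu m = if nu == mu then m else 0.
Proof.
move=> mw; apply: (@wt_decompositionP _ (fun nu =>
  if nu == mu then m else 0) [:: mu]) => //.
- by move=> nu; case: eqP => [->|_]; rewrite ?mem0v.
- by move=> nu; rewrite inE; have [|_] := eqVneq nu mu; rewrite ?eqxx.
- by rewrite big_seq1 eqxx.
Qed.

Lemma wt_proj_linear mu : linear (wt_proj rho mu).
Proof.
move=> a x y.
have [s [us sx xE]] := wt_proj_supp x; have [t [ut ty yE]] := wt_proj_supp y.
have ext (u : seq (Lam r)) z (v := undup (s ++ t)) : uniq u ->
  {subset u <= s ++ t} ->
    (forall mu, wt_proj rho mu z != 0 -> mu \in u) ->
    z = \sum_(mu <- u) wt_proj rho mu z -> z = \sum_(mu <- v) wt_proj rho mu z.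
  move=> uu uv uz zE; have vz nu : wt_proj rho nu z != 0 -> nu \in v.
    by move=> /uz h; rewrite mem_undup; exact: uv.
  rewrite {1}zE -(fsum_seq uu uz) (fsum_seq (undup_uniq _) vz) //.
apply: (@wt_decompositionP _ (fun nu => a *: wt_proj rho nu x + wt_proj rho nu y)
  (undup (s ++ t))); first exact: undup_uniq.
- by move=> nu; rewrite memvD ?memvZ ?wt_proj_in.
- move=> nu; rewrite mem_undup mem_cat; apply: contraNT;
  rewrite negb_or => /andP[ns nt].
  have -> : wt_proj rho nu x = 0 by apply/eqP; apply: contraNT ns; exact: sx.
  have -> : wt_proj rho nu y = 0 by apply/eqP; apply: contraNT nt; exact: ty.
  by rewrite scaler0 addr0.
rewrite {1}(ext s x us _ sx xE); last by move=> nu; rewrite mem_cat => ->.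
rewrite {1}(ext t y ut _ ty yE); last by move=> nu; rewrite mem_cat orbC => ->.
by rewrite scaler_sumr -big_split.
Qed.
HB.instance Definition _ mu :=
  GRing.isLinear.Build Qq M M _ (wt_proj rho mu) (wt_proj_linear mu).

(** Every weight of M occurs in the decomposition of some vector of a fixed basis. *)
Lemma wt_finite : exists2 s : seq (Lam r), uniq s &
  forall mu m, m \in wt mu -> m != 0 -> mu \in s.
Proof.
pose b := vbasis (fullv : {vspace M}).
have /boolp.choice[S SP] : forall i : 'I_(\dim (fullv : {vspace M})),
    exists s : seq (Lam r), forall mu, wt_proj rho mu b`_i != 0 -> mu \in s.
  by move=> i; have [s [_ h _]] := wt_proj_supp b`_i; exists s.
exists (undup (flatten [seq S i | i <- enum 'I_(\dim (fullv : {vspace M}))])).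
  exact: undup_uniq.
move=> mu m mw; apply: contraNT => muS.
have := wt_proj_wt mw mu; rewrite eqxx => <-.
rewrite (coord_vbasis (memvf m)) linear_sum /= big1 // => i _.
rewrite linearZ_LR /=; apply/eqP; rewrite scaler_eq0; apply/orP; right.
apply: contraNT muS => h; rewrite mem_undup; apply/flatten_mapP.
by exists i; rewrite ?mem_enum //; exact: SP.
Qed.

Lemma wt_sum (s : seq (Lam r)) m : uniq s ->
  (forall mu m, m \in wt mu -> m != 0 -> mu \in s) ->
  m = \sum_(mu <- s) wt_proj rho mu m.
Proof.
move=> us sP; have [_ _ {1}->] := wt_projP m.
by apply: fsum_seq => // mu; apply: sP; exact: wt_proj_in.
Qed.

Lemma weight_ind (P : M -> Prop) : P 0 -> (forall x y, P x -> P y -> P (x + y)) ->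
  (forall mu x, x \in wt mu -> P x) -> forall x, P x.
Proof.
move=> P0 PD Pw x; have [s us sP] := wt_finite.
rewrite (wt_sum x us sP); elim: s {us sP} => [|mu s IH]; first by rewrite big_nil.
by rewrite big_cons; apply: PD => //; apply: Pw (wt_proj_in _ _).
Qed.

End Weights.

Section Pairing.
Variable r : nat.
Implicit Types (mu nu : Lam r) (i j : idx r).

Lemma pairingC mu nu : pairing mu nu = pairing nu mu.
Proof. by apply: eq_bigr => a _; rewrite mulrC. Qed.

Lemma pairing_linear mu : linear_for *%R (pairing mu).
Proof.
by move=> a x y; rewrite mulr_sumr -big_split; apply: eq_bigr => b _;
  rewrite !mxE /=; ring.
Qed.
HB.instance Definition _ mu :=
  GRing.isLinear.Build int (Lam r) int *%R (pairing mu) (pairing_linear mu).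

Lemma pairing_alpha i nu : pairing (alpha i) nu = nu 0 (lo i) - nu 0 (hi i).
Proof.
rewrite /pairing (eq_bigr (fun a =>
  (a == lo i)%:R * nu 0 a - (a == hi i)%:R * nu 0 a)).
  by rewrite sumrB (bigD1 (lo i)) //= [in X in _ - X](bigD1 (hi i)) //= !eqxx !mul1r
    !big1 ?addr0 // => a /negbTE ->; rewrite mul0r.
by move=> a _; rewrite !mxE /= mulrBl.
Qed.

Lemma cartanE i j : pairing (alpha i) (alpha j) =
  if i == j then 2 else if (i.+1 == j :> nat) || (j.+1 == i :> nat) then -1 else 0.
Proof.
rewrite pairing_alpha !mxE !eqxx /= -!val_eqE /= /bump !leq0n !add1n !eqSS.
by do ![case: eqP => //=]; lia.
Qed.

Lemma cartan_diag i : pairing (alpha i) (alpha i) = 2.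
Proof. by rewrite cartanE eqxx. Qed.

Lemma cartan_adj i j : i.+1 = j :> nat \/ j.+1 = i :> nat ->
  pairing (alpha i) (alpha j) = -1.
Proof. by rewrite cartanE -val_eqE /=; do ![case: eqP => //=]; lia. Qed.

Lemma cartan_far i j : (i.+1 < j)%N || (j.+1 < i)%N ->
  pairing (alpha i) (alpha j) = 0.
Proof. by rewrite cartanE -val_eqE /=; do ![case: eqP => //=]; lia. Qed.

End Pairing.

Section ModuleOperators.
Variables (r : nat) (M : vectType Qq) (rho : weight_module r M).
Local Notation wt := (Defs.wt rho).
Implicit Types (mu nu : Lam r) (m x : M) (i j : idx r).

Lemma act_mul (u v : U r) m : act rho (u * v) m = act rho u (act rho v m).
Proof. by rewrite actM comp_lfunE. Qed.

Lemma act_one m : act rho 1 m = m.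
Proof. by rewrite act1 id_lfunE. Qed.

Lemma act_scale a (u : U r) m : act rho (a *: u) m = a *: act rho u m.
Proof. by rewrite linearZ_LR scale_lfunE. Qed.

Lemma act_add (u v : U r) m : act rho (u + v) m = act rho u m + act rho v m.
Proof. by rewrite raddfD add_lfunE. Qed.

Lemma act_sub (u v : U r) m : act rho (u - v) m = act rho u m - act rho v m.
Proof. by rewrite raddfB /= add_lfunE opp_lfunE. Qed.

Lemma act_Z (u : U r) a m : act rho u (a *: m) = a *: act rho u m.
Proof. exact: linearZ_LR. Qed.

Lemma act_D (u : U r) m m' : act rho u (m + m') = act rho u m + act rho u m'.
Proof. exact: raddfD. Qed.

Lemma act_0 (u : U r) : act rho u 0 = 0.
Proof. exact: raddf0. Qed.

(** The integral grading for the sl2 of index i; it merges all weights having the same pairing with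
    alpha_i. *)
Definition Kwt i (n : int) m : Prop := act rho (K i) m = q ^ n *: m.

Lemma wt_Kwt i mu m : m \in wt mu -> Kwt i (pairing (alpha i) mu) m.
Proof. exact: act_K. Qed.

Lemma Kwt_Kv i n m : Kwt i n m -> act rho (Kv i) m = q ^ (- n) *: m.
Proof.
move=> h; apply: (scalerI (expfz_neq0 n q_neq0)).
rewrite scalerA -expfzDr ?q_neq0 // subrr expr0z scale1r.
by rewrite -act_Z -h -act_mul KvK act_one.
Qed.

Lemma Kwt_E i j n m : Kwt i n m ->
  Kwt i (n + pairing (alpha i) (alpha j)) (act rho (E j) m).
Proof.
move=> h; rewrite /Kwt -act_mul.
have -> : K i * E j = (q ^ pairing (alpha i) (alpha j) *: E j) * K i.
  by rewrite -KE -[RHS]mulrA KvK mulr1.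
by rewrite act_mul act_scale h act_Z scalerA mulrC -expfzDr ?q_neq0 // addrC.
Qed.

Lemma Kwt_F i j n m : Kwt i n m ->
  Kwt i (n - pairing (alpha i) (alpha j)) (act rho (F j) m).
Proof.
move=> h; rewrite /Kwt -act_mul.
have -> : K i * F j = (q ^ (- pairing (alpha i) (alpha j)) *: F j) * K i.
  by rewrite -KF -[RHS]mulrA KvK mulr1.
by rewrite act_mul act_scale h act_Z scalerA mulrC -expfzDr ?q_neq0 // addrC.
Qed.

(** The weights mu + k b are pairwise distinct, and only finitely many weights occur in M. *)
Lemma iter_nil (G : {linear M -> M}) (b : Lam r) :
  (forall mu m, m \in wt mu -> G m \in wt (mu + b)) ->
  injective (fun k => b *+ k) -> 
  exists N0, forall N, (N0 <= N)%N -> forall m, iter N G m = 0.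
Proof.
move=> Gw binj; have [s us sP] := wt_finite rho.
exists (size s).+1 => N sN;
  have iterL k x y : iter k G (x + y) = iter k G x + iter k G y.
  by elim: k => //= k ->; rewrite raddfD.
apply: (weight_ind (rho := rho)) => [|x y hx hy|mu x xw].
- by elim: N {sN} => //= N ->; rewrite raddf0.
- by rewrite iterL hx hy addr0.
have iw k : iter k G x \in wt (mu + b *+ k).
  elim: k => [|k IH]; first by rewrite mulr0n addr0.
  by rewrite mulrSr addrA; exact: Gw.
apply/eqP; apply: contraTT sN => nz; rewrite -ltnNge ltnS.
have nzk k : (k <= N)%N -> iter k G x != 0.
  move=> kN; apply: contraNneq nz; rewrite -(subnK kN) iterD => ->.
  by elim: (N - k)%N => //= n /eqP ->; rewrite raddf0.
have -> : N = size [seq mu + b *+ k | k <- iota 0 N] by rewrite size_map size_iota.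
apply: uniq_leq_size.
  by rewrite map_inj_uniq ?iota_uniq // => k l /addrI /binj.
move=> nu /mapP[k]; rewrite mem_iota => /andP[_ kN] ->.
by apply: sP (iw k) (nzk _ _); rewrite ltnW.
Qed.

(** A single bound [N] for all i, so that [braid_op_comm] can compare operators of different
    indices. *)
Lemma sl2_rho : exists N, forall i,
  sl2_module q N (Kwt i) (act rho (E i)) (act rho (F i)).
Proof.
have ainj i : injective (fun k => alpha i *+ k).
  move=> k l /(congr1 (pairing (alpha i))); rewrite !raddfMn /= cartan_diag; lia.
have /boolp.choice[NE NEP] : forall i, exists N0, forall N, (N0 <= N)%N -> 
    forall m, iter N (act rho (E i)) m = 0.
  by move=> i; apply: (iter_nil (b := alpha i)) => //; exact: act_E.
have /boolp.choice[NF NFP] : forall i, exists N0, forall N, (N0 <= N)%N -> 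
    forall m, iter N (act rho (F i)) m = 0.
  move=> i; apply: (iter_nil (b := - alpha i)); first exact: act_F.
  by move=> k l; rewrite !mulNrn => /oppr_inj /ainj.
exists (\max_i maxn (NE i) (NF i)) => i.
split.
- by move=> n; rewrite /Kwt act_0 scaler0.
- by move=> n x y; rewrite /Kwt act_D scalerDr => -> ->.
- by move=> n a x; rewrite /Kwt act_Z => ->; rewrite scalerA mulrC -scalerA.
- by move=> n x /(Kwt_E i); rewrite cartan_diag.
- by move=> n x /(Kwt_F i); rewrite cartan_diag.
- move=> n x h /=; rewrite -!act_mul -act_sub EF eqxx act_scale act_sub h (Kwt_Kv
  h).
  by rewrite -scalerBl scalerA qnumE mulrC mul1r.
- by apply: NEP; apply: leq_trans (leq_bigmax i); rewrite leq_maxl.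
- by apply: NFP; apply: leq_trans (leq_bigmax i); rewrite leq_maxr.
- move=> P P0 PD Pw; apply: (weight_ind (rho := rho)) => // mu x xw.
  exact: Pw (wt_Kwt i xw).
Qed.

End ModuleOperators.

(** * Braid operators *)

Section BraidWeights.
Variables (r : nat) (M : vectType Qq) (rho : weight_module r M) (N : nat).
Hypothesis sl2 : forall i,
  sl2_module q N (Kwt rho i) (act rho (E i)) (act rho (F i)).
Local Notation wt := (Defs.wt rho).
Local Notation Ei i := (act rho (E i)).
Local Notation Fi i := (act rho (F i)).
Implicit Types (mu nu : Lam r) (m x : M) (i j : idx r).

Lemma qfactE a : qfact a = qfac q a.
Proof.
elim: a => [|a IH]; first by rewrite /qfact big_geq // /qfac.
rewrite /qfact big_nat_recr //= -/(qfact a) IH (qfacS q_neq0) mulrC; congr (_ * _).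
by rewrite qnumE /qint -exprnN.
Qed.

Lemma act_divpow (u : U r) a m : act rho (divpow u a) m = divp q (act rho u) a m.
Proof.
rewrite act_scale divpE qfactE; congr (_ *: _).
by elim: a => [|a IH] /=; [rewrite act_one|rewrite exprS act_mul IH].
Qed.

Lemma divp_large (G : {linear M -> M}) a m : (forall x, iter N G x = 0) ->
  (N <= a)%N ->
  divp q G a m = 0.
Proof.
move=> GN Na; rewrite divpE -(subnK Na) iterD GN.
have -> : iter (a - N) G 0 = 0 by elim: (a - N)%N => //= n ->; rewrite raddf0.
by rewrite scaler0.
Qed.

Lemma divpE_large i a m : (N <= a)%N -> divp q (Ei i) a m = 0.
Proof. by apply: divp_large; exact: nilE (sl2 i). Qed.

Lemma divpF_large i a m : (N <= a)%N -> divp q (Fi i) a m = 0.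
Proof. by apply: divp_large; exact: nilF (sl2 i). Qed.

Lemma fsum_triples (V : zmodType) (P : set (nat * nat * nat)) (f : nat * nat *
  nat -> V) :
  (forall a b c, f (a, b, c) != 0 -> [/\ (a < N)%N, (b < N)%N & (c < N)%N]) ->
  \sum_(p \in P) f p =
  \sum_(a < N) \sum_(c < N) \sum_(b < N | `[< P (a : nat, b : nat,
    c : nat) >]) f (a : nat, b : nat, c : nat).
Proof.
move=> fN; rewrite fsbig_mkcond.
pose h (p : 'I_N * 'I_N * 'I_N) : nat * nat * nat := (p.1.1 : nat, p.1.2 : nat,
  p.2 : nat).
rewrite (fsum_seq (s := [seq h p | p <- enum {: 'I_N * 'I_N * 'I_N}])).
- rewrite big_map big_enum /=.
  under [RHS]eq_bigr => a _ do under eq_bigr => c _ do rewrite big_mkcond.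
  under [RHS]eq_bigr => a _ do rewrite exchange_big.
  rewrite pair_bigA pair_bigA /=; apply: eq_bigr => -[[a b] c] _ /=.
  by rewrite /patch /h /=; congr (if _ then _ else _); apply/idP/asboolP;
    rewrite inE.
- rewrite map_inj_uniq ?enum_uniq // => -[[a b] c] [[a' b'] c'] /= [].
  by move=> /val_inj -> /val_inj -> /val_inj ->.
move=> [[a b] c]; rewrite /patch; case: ifP => _; last by rewrite eqxx.
move=> /fN[aN bN cN]; apply/mapP; exists (Ordinal aN, Ordinal bN, Ordinal cN) => //.
by rewrite mem_enum.
Qed.

(** The condition on the triple determines b from a and c, which leaves a double sum. *)
Lemma braid_wtE i lam m : braid_wt rho i lam m =
  \sum_(a < N) \sum_(c < N)
     braid_term q (Ei i) (Fi i) (pairing lam (alpha i)) a c m.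
Proof.
pose f (p : nat * nat * nat) :=
  ((-1) ^+ p.1.2 * q ^ (p.1.2%:Z - (p.1.1 * p.2)%:Z)) *:
  divp q (Ei i) p.1.1 (divp q (Fi i) p.1.2 (divp q (Ei i) p.2 m)).
rewrite /braid_wt (@eq_fsbigr _ _ _ _ _ f); last first.
  by move=> p _; rewrite !act_mul !act_divpow.
rewrite fsum_triples; last first.
  move=> a b c; rewrite /f /=; have [aN|aN] := ltnP a N; last first.
    by rewrite divpE_large // scaler0 eqxx.
  have [bN|bN] := ltnP b N; last by rewrite divpF_large // raddf0 scaler0 eqxx.
  have [cN|cN] := ltnP c N; last by rewrite (divpE_large _ _ cN) !raddf0 eqxx.
  by [].
apply: eq_bigr => a _; apply: eq_bigr => c _.
set n := pairing lam (alpha i); rewrite /braid_term.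
have condE (b : nat) : `[< [set p : nat * nat * nat |
    - p.1.1%:Z + p.1.2%:Z - p.2%:Z = n] (a : nat, b,
      c : nat) >] = (b%:Z == n + a%:Z + c%:Z).
  by apply/asboolP/eqP => /=; lia.
under eq_bigl do rewrite condE.
case: (n + a%:Z + c%:Z) => b /=; last by rewrite big1 ?raddf0 ?scaler0.
have [bN|bN] := ltnP b N.
  rewrite (bigD1 (Ordinal bN)) //= big1 ?addr0 // => b' /andP[/eqP[bE] /negP].
  by case; apply/eqP/val_inj.
rewrite divpF_large // raddf0 scaler0 big1 // => b' /eqP[bE].
by have := ltn_ord b'; rewrite bE ltnNge bN.
Qed.

End BraidWeights.

Section Braid.
Variables (r : nat) (M : vectType Qq) (rho : weight_module r M).
Local Notation wt := (Defs.wt rho).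
Local Notation Ei i := (act rho (E i)).
Local Notation Fi i := (act rho (F i)).
Implicit Types (mu nu : Lam r) (m x : M) (i j : idx r).

Lemma braid_wt_linear i lam : linear (braid_wt rho i lam).
Proof.
have [N sl2] := sl2_rho rho; move=> a x y; rewrite !(braid_wtE sl2).
rewrite scaler_sumr -big_split; apply: eq_bigr => b _.
rewrite scaler_sumr -big_split; apply: eq_bigr => c _ /=; rewrite /braid_term.
case: (_ + _) => k /=; last by rewrite !(raddf0, scaler0, addr0).
by rewrite !divp_linear scalerDr !scalerA mulrC.
Qed.
HB.instance Definition _ i lam :=
  GRing.isLinear.Build Qq M M _ (braid_wt rho i lam) (braid_wt_linear i lam).

Lemma braid_sum i (s : seq (Lam r)) m : uniq s ->
  (forall mu m, m \in wt mu -> m != 0 -> mu \in s) ->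
  braid rho i m = \sum_(lam <- s) braid_wt rho i lam (wt_proj rho lam m).
Proof.
move=> us sP; apply: fsum_seq => // lam; apply: contraNT => ls.
rewrite (_ : wt_proj rho lam m = 0) ?raddf0 //; apply/eqP; apply: contraNT ls.
by apply: sP; exact: wt_proj_in.
Qed.

Lemma braid_linear i : linear (braid rho i).
Proof.
have [s us sP] := wt_finite rho; move=> a x y; rewrite !(braid_sum i _ us sP).
rewrite scaler_sumr -big_split; apply: eq_bigr => lam _ /=.
by rewrite !linearP.
Qed.
HB.instance Definition _ i :=
  GRing.isLinear.Build Qq M M _ (braid rho i) (braid_linear i).

Lemma braid_weight i lam m : m \in wt lam -> braid rho i m = braid_wt rho i lam m.
Proof.
move=> ml; have [s us sP] := wt_finite rho; rewrite (braid_sum i m us sP).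
have [->|m0] := eqVneq m 0.
  by rewrite raddf0 big1 // => nu _; rewrite !raddf0.
rewrite (bigD1_seq lam) //=; last exact: sP ml m0.
rewrite (wt_proj_wt ml) eqxx big1 ?addr0 // => nu /negbTE nl.
by rewrite (wt_proj_wt ml) nl raddf0.
Qed.

Lemma wt_proj_K i mu m : wt_proj rho mu (act rho (K i) m) =
  q ^ pairing (alpha i) mu *: wt_proj rho mu m.
Proof.
move: m; apply: (weight_ind (rho := rho)) => [|x y hx hy|nu x xn].
- by rewrite !raddf0.
- by rewrite !raddfD /= hx hy.
rewrite (act_K _ xn) linearZ_LR /= (wt_proj_wt xn); case: eqP => [->|] //.
by rewrite !scaler0.
Qed.

Lemma wt_proj_Kwt i n mu m : Kwt rho i n m -> wt_proj rho mu m != 0 ->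
  pairing (alpha i) mu = n.
Proof.
move=> Km pm; have := wt_proj_K i mu m; rewrite Km linearZ_LR /= => /eqP.
rewrite -subr_eq0 -scalerBl scaler_eq0 (negbTE pm) orbF subr_eq0 => /eqP.
by move/(expq_inj q_neq0 q_nroot).
Qed.

(** An eigenvector of K_i may have components of several weights, but these all pair equally with
    alpha_i and are subject to the same formula. *)
Lemma braid_opP N : (forall i, sl2_module q N (Kwt rho i) (Ei i) (Fi i)) ->
  forall i, braid_op q N (Kwt rho i) (Ei i) (Fi i) (braid rho i).
Proof.
move=> sl2 i n x Kx; have [s us sP] := wt_finite rho; rewrite (braid_sum i x us sP).
pose G y := \sum_(a < N) \sum_(c < N) braid_term q (Ei i) (Fi i) n a c y.
have G0 : G 0 = 0.
  rewrite /G big1 // => a _; rewrite big1 // => c _; rewrite /braid_term.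
  by case: (_ + _) => k /=; rewrite !(raddf0, scaler0).
have GD y z : G (y + z) = G y + G z.
  rewrite /G -big_split; apply: eq_bigr => a _; rewrite -big_split;
    apply: eq_bigr => c _.
  rewrite /braid_term; case: (_ + _) => k /=;
    last by rewrite !(raddf0, scaler0, addr0).
  by rewrite !raddfD.
rewrite -/(G x) {2}(wt_sum x us sP) (big_morph G GD G0); apply: eq_bigr => lam _.
have [->|p0] := eqVneq (wt_proj rho lam x) 0; first by rewrite raddf0 G0.
by rewrite (braid_wtE sl2) pairingC (wt_proj_Kwt Kx p0).
Qed.

End Braid.

(** * Commutation of the braid operators with the generators and with each other *)

Section BraidRelations.
Variables (r : nat) (M : vectType Qq) (rho : weight_module r M) (N : nat).
Hypothesis sl2 : forall i,
  sl2_module q N (Kwt rho i) (act rho (E i)) (act rho (F i)).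
Local Notation wt := (Defs.wt rho).
Local Notation Ei i := (act rho (E i)).
Local Notation Fi i := (act rho (F i)).
Local Notation Ki i := (act rho (K i)).

Local Notation T := (braid rho).
Implicit Types (mu nu : Lam r) (m x : M) (i j : idx r).

Let braid_str i : string_op q (Kwt rho i) (Ei i) (Fi i) 1 (T i) :=
  string_op_braid q_neq0 q_nroot (sl2 i) (braid_opP sl2 (i:=i)).
Let braid_str' i : string_op q (fun n =>
  Kwt rho i (- n)) (Fi i) (Ei i) (- q)^-1 (T i) :=
  string_op_twist q_neq0 q_nroot (sl2 i) (@braid_str i).
Let sl2' i := sl2_twist (sl2 i).

Lemma Nq_neq0 : (- q)^-1 != 0 :> Qq.
Proof. by rewrite invr_neq0 // oppr_eq0 q_neq0. Qed.

Lemma KE_act i j x :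
  Ki i (Ei j x) = q ^ pairing (alpha i) (alpha j) *: Ei j (Ki i x).
Proof.
rewrite -!act_mul -act_scale; congr (act rho _ x).
by rewrite scalerAl -KE -[RHS]mulrA KvK mulr1.
Qed.

Lemma KF_act i j x :
  Ki i (Fi j x) = q ^ (- pairing (alpha i) (alpha j)) *: Fi j (Ki i x).
Proof.
rewrite -!act_mul -act_scale; congr (act rho _ x).
by rewrite scalerAl -KF -[RHS]mulrA KvK mulr1.
Qed.

Lemma EF_act i j x : i != j -> Ei i (Fi j x) = Fi j (Ei i x).
Proof.
move=> /negbTE ij; apply/eqP;
  rewrite -subr_eq0 -!act_mul -act_sub EF ij mul0r scale0r.
by rewrite linear0 zero_lfunE.
Qed.

Lemma braidE i x : T i (Ei i x) = - Fi i (Ki i (T i x)).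
Proof.
move: x; apply: (wt_ind (sl2 i)) => [|x y hx hy|n x wx].
- by rewrite !raddf0.
- by rewrite !raddfD /= hx hy.
rewrite (braid_E q_neq0 q_nroot (sl2 i) (oner_neq0 _) (@braid_str i) wx).
have -> := braid_wtN q_neq0 q_nroot (sl2 i) (oner_neq0 _) (@braid_str i) wx.
by rewrite act_Z expr1n mul1r scaleNr.
Qed.

Lemma braidF i x : T i (Fi i x) = - act rho (Kv i) (Ei i (T i x)).
Proof.
move: x; apply: (wt_ind (sl2 i)) => [|x y hx hy|n x wx].
- by rewrite !raddf0.
- by rewrite !raddfD /= hx hy.
have wx' : Kwt rho i (- - n) x by rewrite opprK.
rewrite (braid_E q_neq0 q_nroot (sl2' i) Nq_neq0 (@braid_str' i) wx').
have wz := braid_wtN q_neq0 q_nroot (sl2 i) (oner_neq0 _) (@braid_str i) wx.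
rewrite (Kwt_Kv (wtE (sl2 i) wz)) -scaleNr; congr (- _ *: _).
by rewrite exprVn sqrrN (exprnP q) invr_expz -expfzDr ?q_neq0 //; congr (q ^ _);
  lia.
Qed.

Lemma braid_surjective i y : exists x, T i x = y.
Proof. exact: (braid_surj q_neq0 q_nroot (sl2 i) (oner_neq0 _) (@braid_str i)). Qed.

Lemma braid_comm_far i j x : (i.+1 < j)%N || (j.+1 < i)%N ->
  [/\ T i (Ei j x) = Ei j (T i x), T i (Fi j x) = Fi j (T i x)
    & T i (Ki j x) = Ki j (T i x)].
Proof.
move=> ij; have aij := cartan_far ij; have aji : pairing (alpha j) (alpha i) = 0.
  by apply: cartan_far; rewrite orbC.
have nij : i != j by apply/eqP => eij; move: ij; rewrite eij; lia.
have nji : j != i by rewrite eq_sym.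
split; symmetry.
- apply: (braid_op_comm (sl2 i) (braid_opP sl2 (i:=i)) (braid_opP sl2 (i:=i))) =>
  [y|y|n y].
  + by rewrite /= -!act_mul (EE0 aij).
  + exact: EF_act.
  + by move/(Kwt_E j); rewrite aij addr0.
- apply: (braid_op_comm (sl2 i) (braid_opP sl2 (i:=i)) (braid_opP sl2 (i:=i))) =>
  [y|y|n y].
  + by symmetry; exact: EF_act.
  + by rewrite /= -!act_mul (FF0 aij).
  + by move/(Kwt_F j); rewrite aij subr0.
- apply: (braid_op_comm (sl2 i) (braid_opP sl2 (i:=i)) (braid_opP sl2 (i:=i))) =>
  [y|y|n y].
  + by rewrite /= KE_act aji expr0z scale1r.
  + by rewrite /= KF_act aji oppr0 expr0z scale1r.
  + by rewrite /Kwt /= => h; rewrite -act_mul KK act_mul h act_Z.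
Qed.

Lemma braid_adj_E i j x : i.+1 = j :> nat \/ j.+1 = i :> nat ->
  T i (T j (Ei i x)) = Ei j (T i (T j x)).
Proof.
move=> ij; have aij := cartan_adj ij; have aji : pairing (alpha j) (alpha i) = -1.
  by rewrite pairingC.
have nij : i != j by apply/eqP => eij; move: ij; rewrite eij; lia.
have nji : j != i by rewrite eq_sym.
have serre k l y : pairing (alpha k) (alpha l) = -1 ->
    Ei k (Ei k (Ei l y)) + Ei l (Ei k (Ei k y)) =
      (q + q^-1) *: Ei k (Ei l (Ei k y)).
  by move=> kl; rewrite -!act_mul -act_add -act_scale EE1.
rewrite (@braid_X _ _ q_neq0 q_nroot _ _ _ _ _ (Ei i) _ _ (sl2 j) (oner_neq0 _)
  (@braid_str j)).
- rewrite invr1 scale1r.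
  rewrite (@braid_X_inv _ _ q_neq0 q_nroot _ _ _ _ _ (Ei j) _ _ (sl2 i)
    (oner_neq0 _) (@braid_str i)).
  + by rewrite scale1r.
  + by move=> y; exact: EF_act.
  + by move=> n y /(Kwt_E j); rewrite aij.
  + by move=> y; exact: serre.
- by move=> y; exact: EF_act.
- by move=> n y /(Kwt_E i); rewrite aji.
- by move=> y; exact: serre.
Qed.

(** The argument for E_i with E and F exchanged; the factor t^-1 of the first step cancels the
    factor t of the second. *)
Lemma braid_adj_F i j x : i.+1 = j :> nat \/ j.+1 = i :> nat ->
  T i (T j (Fi i x)) = Fi j (T i (T j x)).
Proof.
move=> ij; have aij := cartan_adj ij; have aji : pairing (alpha j) (alpha i) = -1.
  by rewrite pairingC.
have nij : i != j by apply/eqP => eij; move: ij; rewrite eij; lia.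
have nji : j != i by rewrite eq_sym.
have serre k l y : pairing (alpha k) (alpha l) = -1 ->
    Fi k (Fi k (Fi l y)) + Fi l (Fi k (Fi k y)) =
      (q + q^-1) *: Fi k (Fi l (Fi k y)).
  by move=> kl; rewrite -!act_mul -act_add -act_scale FF1.
rewrite (@braid_X _ _ q_neq0 q_nroot _ _ _ _ _ (Fi i) _ _ (sl2' j) Nq_neq0
  (@braid_str' j)).
- rewrite linearZ_LR.
  rewrite (@braid_X_inv _ _ q_neq0 q_nroot _ _ _ _ _ (Fi j) _ _ (sl2' i) Nq_neq0
    (@braid_str' i)).
  + by rewrite /= scalerA mulVf ?scale1r // Nq_neq0.
  + by move=> y; symmetry; exact: EF_act.
  + by move=> n y /(Kwt_F j); rewrite aij opprD.
  + by move=> y; exact: serre.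
- by move=> y; symmetry; exact: EF_act.
- by move=> n y /(Kwt_F i); rewrite aji opprD.
- by move=> y; exact: serre.
Qed.

Lemma divp_in (G : {linear M -> M}) (b : Lam r) k mu x :
  (forall mu m, m \in wt mu -> G m \in wt (mu + b)) ->
  x \in wt mu -> divp q G k x \in wt (mu + b *+ k).
Proof.
move=> Gw xw; rewrite divpE memvZ //; elim: k => [|k IH];
  first by rewrite mulr0n addr0.
by rewrite mulrSr addrA; exact: Gw.
Qed.

Lemma braid_in i mu x : x \in wt mu ->
  T i x \in wt (mu - alpha i *~ pairing mu (alpha i)).
Proof.
move=> xw; rewrite /= (braid_weight i xw) (braid_wtE sl2).
apply: memv_suml => a _; apply: memv_suml => c _; rewrite memvZ //.
case bE: (_ + _) => [b|b] /=; last by rewrite raddf0 mem0v.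
have xc := divp_in c (@act_E _ _ rho i) xw.
have xb := divp_in b (@act_F _ _ rho i) xc.
have := divp_in a (@act_E _ _ rho i) xb.
have nE : pairing mu (alpha i) = b%:Z - a%:Z - c%:Z by rewrite -bE; lia.
rewrite -!addrA; congr (_ \in wt (mu + _)).
rewrite nE; move: (alpha i) => al; rewrite !mulrzBr !opprB mulNrn -!pmulrn.
by rewrite [- _ + _]addrC.
Qed.

(** T_i T_j moves weights by s_i s_j, and s_i s_j alpha_i = alpha_j. *)
Lemma braid_adj_K i j x : i.+1 = j :> nat \/ j.+1 = i :> nat ->
  T i (T j (Ki i x)) = Ki j (T i (T j x)).
Proof.
move=> ij; have aij := cartan_adj ij; have aji : pairing (alpha j) (alpha i) = -1.
  by rewrite pairingC.
move: x; apply: (weight_ind (rho := rho)) => [|x y hx hy|mu x xw].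
- by rewrite !raddf0.
- by rewrite !raddfD /= hx hy.
have := braid_in i (braid_in j xw) => /act_K ->.
rewrite (act_K _ xw) !linearZ_LR; congr (q ^ _ *: _).
have lin (a b c : Lam r) z : pairing a (b - c *~ z) = pairing a b - z * pairing a c.
  by rewrite raddfB /= raddfMz /= mulrzz mulrC.
rewrite !lin (pairingC (mu - _) (alpha i)) lin (pairingC mu (alpha j)).
by rewrite aij aji cartan_diag; lia.
Qed.

Lemma braid_braid i j x : i.+1 = j :> nat \/ j.+1 = i :> nat ->
  T i (T j (T i x)) = T j (T i (T j x)).
Proof.
move=> ij.
apply: (@braid_op_comm _ _ _ _ _ _ _ _ _ _ (T i) (T j) (T i \o T j) (sl2 i)
  (braid_opP sl2 (i:=i))
  (braid_opP sl2 (i:=j))) => [y|y|n y] /=.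
- exact: braid_adj_E.
- exact: braid_adj_F.
- by move=> h; rewrite /Kwt -braid_adj_K // h !linearZ_LR.
Qed.

Lemma braid_far i j x : (i.+1 < j)%N || (j.+1 < i)%N -> T i (T j x) = T j (T i x).
Proof.
move=> ij; have h y := braid_comm_far y ij; have ji : (j.+1 < i)%N || (i.+1 < j)%N.
  by rewrite orbC.
apply: (@braid_op_comm _ _ _ _ _ _ _ _ _ _ (T j) (T j) (T i) (sl2 j) (braid_opP
  sl2 (i:=j))
  (braid_opP sl2 (i:=j))) => [y|y|n y].
- by have [] := h y.
- by have [] := h y.
- by move=> wy; have [_ _] := h y; rewrite /Kwt => <-; rewrite wy linearZ_LR.
Qed.

End BraidRelations.

(** * Reduced words and the operator of the longest element *)

Section Longest.
Variable r : nat.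
Implicit Types (w u v : seq (idx r)) (i j : idx r).

(* Words multiply as permutations acting on the right, so [wact w] is the
   inverse of [word_perm w]. *)
Lemma word_permVE w (x : 'I_(r.*2.+2)) : ((word_perm w)^-1%g x : nat) = wact w x.
Proof.
elim: w => [|i w IH]; first by rewrite /word_perm big_nil invg1 perm1.
rewrite /word_perm big_cons invMg permM tpermV /= -/(word_perm w) -IH.
move: ((word_perm w)^-1%g x) => y; rewrite /swap.
have lo_i : lo i = i :> nat by []; have hi_i : hi i = i.+1 :> nat by [].
case: tpermP => [->|->|/eqP yl /eqP yh]; first by rewrite lo_i eqxx.
  by rewrite hi_i eqxx; case: eqP => //; lia.
by rewrite -lo_i val_eqE (negbTE yl) lo_i -hi_i val_eqE (negbTE yh).
Qed.

Lemma wact_id w x : (r.*2.+1 < x)%N -> wact w x = x.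
Proof.
move=> rx; elim: w => //= i w IH; rewrite -/(wact w x) IH swap_out //;
  have := ltn_ord i; lia.
Qed.

Lemma word_perm_eq u v : word_perm u = word_perm v <-> wact u =1 wact v.
Proof.
split=> [uv x|uv].
  have [xr|xr] := leqP x r.*2.+1; last by rewrite !wact_id.
  by rewrite -[x]/(nat_of_ord (Ordinal (xr : (x < r.*2.+2)%N))) -!word_permVE uv.
by apply: invg_inj; apply/permP => x; apply: val_inj; rewrite /= !word_permVE uv.
Qed.

(** The purely combinatorial content of [exchange], with trivial operators on [unit]. *)
Let exchange1 := @exchange r.*2.+1 unit (fun _ x => x) (fun _ _ _ _ =>
  erefl) (fun _ _ _ _ => erefl).

Lemma reduced_prefix w i : reduced (rcons w i) -> reduced w.
Proof.
move=> red w' /word_perm_eq ww';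
  rewrite -ltnS -[(size w').+1](size_rcons w' i) -(size_rcons w i).
by apply: red; apply/word_perm_eq => x; rewrite !wact_rcons ww'.
Qed.

(** If the last letter i created no inversion, it would be a right descent of the prefix, and
    cancelling it there would give a word shorter by two. *)
Lemma reduced_increasing w : reduced w -> increasing_word w.
Proof.
elim/last_ind: w => [|w i IH] red; first exact: increasing_nil.
have iw := IH (reduced_prefix red); apply: increasing_rcons => //.
rewrite ltnNge leq_eqVlt; apply/negP => /orP[/eqP/wact_inj|lt]; first by lia.
have [u _ [wE _ sE]] := exchange1 iw lt.
have : (size (rcons w i) <= size u)%N.
  by apply: red; apply/word_perm_eq => x; rewrite wact_rcons wE wact_rcons swapK.
by rewrite !size_rcons sE size_rcons; lia.
Qed.

Lemma exists_reduced w : exists w', [/\ reduced w',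
  word_perm w' = word_perm w & (size w' <= size w)%N].
Proof.
have [n] := ubnP (size w); elim: n w => // n IH w; rewrite ltnS => wn.
have [red|nred] := pselect (reduced w); first by exists w.
have [w1 [w1w lt]] : exists w1, word_perm w1 = word_perm w /\ (size w1 < size w)%N.
  apply: contrapT => no; apply: nred => w1 w1w; rewrite leqNgt; apply/negP => lt.
  by apply: no; exists w1.
have [w' [red' ww' le]] := IH w1 (leq_trans lt wn).
by exists w'; split=> //; [rewrite ww'|apply: leq_trans le (ltnW lt)].
Qed.

(** A reduced word of the same permutation is increasing too, and [increasing_size] compares the
    lengths. *)
Lemma increasing_reduced w : increasing_word w -> reduced w.
Proof.
move=> iw w' w'w; have [u [redu uw' le]] := exists_reduced w'.
rewrite -(increasing_size (T := fun _ (x : unit) => x) (fun _ _ _ _ => erefl)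
  (fun _ _ _ _ => erefl) (reduced_increasing redu) iw) //.
by apply/word_perm_eq; rewrite uw' w'w.
Qed.

(** A longest word cannot be extended, so every i is a descent; a strictly decreasing map from {0,
    ..., 2r+1} to itself is the reversal. *)
Lemma longest_wact w x : longest_reduced w -> (x <= r.*2.+1)%N ->
  wact w x = (r.*2.+1 - x)%N.
Proof.
case=> red max xr; have iw := reduced_increasing red.
have desc i : (wact w i.+1 < wact w i)%N.
  rewrite ltnNge leq_eqVlt; apply/negP => /orP[/eqP/wact_inj|lt]; first by lia.
  have := max _ (increasing_reduced (increasing_rcons iw lt)).
  by rewrite size_rcons ltnn.
have ge k : (k <= r.*2.+1)%N -> (wact w k + k <= wact w 0)%N.
  elim: k => [|k IH] kr; first by rewrite addn0.
  by have := desc (Ordinal (kr : (k < r.*2.+1)%N)); have := IH (ltnW kr);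
    rewrite /=; lia.
have le d : (d <= r.*2.+1)%N -> (wact w r.*2.+1 + d <= wact w (r.*2.+1 - d))%N.
  elim: d => [|d IH] dr; first by rewrite subn0 addn0.
  have ok : (r.*2.+1 - d.+1 < r.*2.+1)%N by lia.
  have := desc (Ordinal ok); have := IH (ltnW dr); rewrite /=.
  by rewrite (_ : (r.*2.+1 - d.+1).+1 = (r.*2.+1 - d)%N); lia.
have w0 := wact_le w (leq0n r.*2.+1).
by have := ge _ xr; have := le _ (leq_subr x r.*2.+1); rewrite subKn //; lia.
Qed.

Variables (M : vectType Qq) (rho : weight_module r M).
Local Notation T := (braid_word rho).

Lemma braid_word_linear w : linear (T w).
Proof.
elim: w => [|i w IH] a x y //=.
by rewrite -!/(braid_word rho w _) IH linearP.
Qed.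
HB.instance Definition _ w :=
  GRing.isLinear.Build Qq M M _ (T w) (braid_word_linear w).

Lemma braid_word_surjective w y : exists x, T w x = y.
Proof.
have [N sl2] := sl2_rho rho; elim: w y => [|i w IH] y; first by exists y.
by have [z <-] := braid_surjective sl2 i y; have [x <-] := IH z; exists x.
Qed.

Lemma braid_longest w i : longest_reduced w ->
  [/\ forall x, T w (act rho (E i) x) =
        - act rho (F (rev_ord i)) (act rho (K (rev_ord i)) (T w x)),
      forall x, T w (act rho (F i) x) =
        - act rho (Kv (rev_ord i)) (act rho (E (rev_ord i)) (T w x))
    & forall x, T w (act rho (K i) x) = act rho (Kv (rev_ord i)) (T w x)].
Proof.
move=> lw; have [N sl2] := sl2_rho rho.
have iw := reduced_increasing lw.1.
have br (j k : idx r) x : j.+1 = k :> nat ->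
  braid rho j (braid rho k (braid rho j x)) =
    braid rho k (braid rho j (braid rho k x)).
  by move=> jk; apply: (braid_braid sl2); left.
have cm (j k : idx r) x : (j.+1 < k)%N ->
  braid rho j (braid rho k x) = braid rho k (braid rho j x).
  by move=> jk; apply: (braid_far sl2); rewrite jk.
have wi : wact w i = (rev_ord i).+1.
  by rewrite (longest_wact lw) /=; have := ltn_ord i; lia.
have wi1 : wact w i.+1 = rev_ord i.
  by rewrite (longest_wact lw) /=; have := ltn_ord i; lia.
have [u [iu ui ui1 Tu]] := longest_split br cm iw wi wi1.
have TE x : T u (act rho (E i) x) = act rho (E (rev_ord i)) (T u x).
  apply: (tact_simple br cm (A := fun i => act rho (E i))) =>
    // [j k y jk|j k y jk].
    exact: (braid_adj_E sl2).
  by have [] := braid_comm_far sl2 y jk.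
have TF x : T u (act rho (F i) x) = act rho (F (rev_ord i)) (T u x).
  apply: (tact_simple br cm (A := fun i => act rho (F i))) =>
    // [j k y jk|j k y jk].
    exact: (braid_adj_F sl2).
  by have [] := braid_comm_far sl2 y jk.
have TK x : T u (act rho (K i) x) = act rho (K (rev_ord i)) (T u x).
  apply: (tact_simple br cm (A := fun i => act rho (K i))) =>
    // [j k y jk|j k y jk].
    exact: (braid_adj_K).
  by have [] := braid_comm_far sl2 y jk.
have TKv x : T u (act rho (Kv i) x) = act rho (Kv (rev_ord i)) (T u x).
  have {2}-> : x = act rho (K i) (act rho (Kv i) x).
    by rewrite -act_mul KKv act_one.
  by rewrite TK -act_mul KvK act_one.
have Tw x : T w x = T u (braid rho i x) by exact: Tu.
split=> x; rewrite !Tw.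
- by rewrite (braidE sl2) raddfN /= TF TK.
- by rewrite (braidF sl2) raddfN /= TKv TE.
rewrite -TKv; congr (T u _).
(* T_i negates the weights for K_i, so K_i T_i K_i = T_i, that is, T_i K_i = K_i^-1 T_i. *)
have h y : act rho (K i) (braid rho i (act rho (K i) y)) = braid rho i y.
  move: y; apply: (wt_ind (sl2 i)) => [|a b ha hb|n y wy].
  - by rewrite !raddf0.
  - by rewrite !raddfD /= ha hb.
  have wz := braid_wtN q_neq0 q_nroot (sl2 i) (oner_neq0 _)
    (string_op_braid q_neq0 q_nroot (sl2 i) (braid_opP sl2 (i:=i))) wy.
  rewrite wy linearZ_LR act_Z wz scalerA -expfzDr ?q_neq0 //.
  by rewrite subrr expr0z scale1r.
by rewrite -[in RHS]h -act_mul KvK act_one.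
Qed.

End Longest.

(** * The intertwiner *)

Section RootCone.
Variable r : nat.
Implicit Types (mu nu : Lam r) (i j : idx r) (c d : NPi r).

(** The height extended linearly to all of Lambda: giving the coordinate a the coefficient -a,
    alpha_i gets -i + (i + 1) = 1. *)
Definition lam_ht mu : int := - \sum_a mu 0 a * (a : nat)%:Z.

Lemma lam_ht_linear : linear_for *%R lam_ht.
Proof.
move=> a x y; rewrite /lam_ht mulrN -opprD mulr_sumr -big_split; congr (- _).
by apply: eq_bigr => b _; rewrite !mxE /=; ring.
Qed.
HB.instance Definition _ :=
  GRing.isLinear.Build int (Lam r) int *%R lam_ht lam_ht_linear.

Lemma sum_alpha i (f : 'I_(r.*2.+2) -> int) :
  \sum_a alpha i 0 a * f a = f (lo i) - f (hi i).
Proof.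
have -> : \sum_a alpha i 0 a * f a = pairing (alpha i) (\row_a f a).
  by apply: eq_bigr => a _; rewrite [in RHS]mxE.
by rewrite pairing_alpha !mxE.
Qed.

Lemma lam_ht_alpha i : lam_ht (alpha i) = 1.
Proof. by rewrite /lam_ht (sum_alpha i (fun a => (a : nat)%:Z)) /= /bump leq0n;
  lia. Qed.

Lemma lam_ht_rootsum c : lam_ht (rootsum c) = (ht c)%:Z.
Proof.
rewrite /rootsum /ht raddf_sum (big_morph Posz PoszD (erefl _));
  apply: eq_bigr => i _ /=.
by rewrite raddfMn /= lam_ht_alpha natz.
Qed.

(* The Cartan matrix is nondegenerate: a vector orthogonal to all simple
   roots is constant, and root vectors have coordinate sum 0. *)
Lemma rootsum_eq c d :
  (forall i, pairing (alpha i) (rootsum c) = pairing (alpha i) (rootsum d)) ->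
  rootsum c = rootsum d.
Proof.
move=> h; pose l := rootsum c - rootsum d.
have l0 i : l 0 (lo i) = l 0 (hi i).
  apply/eqP; rewrite -subr_eq0 -pairing_alpha raddfB /= h subrr //.
have lc (a : 'I_(r.*2.+2)) : l 0 a = l 0 ord0.
  case: a => k; elim: k => [|k IH] kr; first by congr (l 0 _); exact: val_inj.
  have ok : (k < r.*2.+1)%N by [].
  have := l0 (Ordinal ok); rewrite (_ : hi _ = Ordinal kr); last first.
    by apply: val_inj; rewrite /= /bump leq0n.
  rewrite (_ : lo _ = Ordinal (ltnW kr)) ?IH //; exact: val_inj.
have sum0 c' : \sum_a (rootsum c') 0 a = 0.
  have -> : \sum_a (rootsum c') 0 a = \sum_a (\sum_i (alpha i 0 a) *+ c' i).
    by apply: eq_bigr => a _; rewrite summxE; apply: eq_bigr => i _;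
      rewrite mulmxnE.
  rewrite exchange_big big1 // => i _; rewrite sumrMnl.
  have -> : \sum_a alpha i 0 a = 0.
    rewrite -[RHS](subrr (1 : int)) -(sum_alpha i (fun=> 1)).
    by apply: eq_bigr => a _; rewrite mulr1.
  by rewrite mul0rn.
have : \sum_a l 0 a = 0.
  rewrite (eq_bigr (fun a => rootsum c 0 a - rootsum d 0 a)) ?sumrB ?sum0 //.
  by move=> a _; rewrite !mxE.
rewrite (eq_bigr (fun=> l 0 ord0)) // sumr_const card_ord => /eqP.
rewrite Num.Theory.mulrn_eq0 /= => /eqP l00; apply/eqP; rewrite -subr_eq0 -/l.
by apply/eqP/rowP => a; rewrite lc l00 mxE.
Qed.

End RootCone.

(** * The action of Upsilon on a module *)

Section Upsilon.
Variables (r : nat) (M : vectType Qq) (rho : weight_module r M).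
Local Notation wt := (Defs.wt rho).
Implicit Types (mu nu : Lam r) (m x : M) (i j : idx r) (c d : NPi r).

Lemma wt_proj_shift (G : {linear M -> M}) (b : Lam r) :
  (forall mu m, m \in wt mu -> G m \in wt (mu + b)) ->
  forall mu m, wt_proj rho mu (G m) = G (wt_proj rho (mu - b) m).
Proof.
move=> Gw mu; apply: (weight_ind (rho := rho)) => [|x y hx hy|nu x xn].
- by rewrite !raddf0.
- by rewrite !raddfD /= hx hy.
rewrite (wt_proj_wt (Gw _ _ xn)) (wt_proj_wt xn) subr_eq.
by case: eqP => // _; rewrite raddf0.
Qed.

Lemma wt_of_proj mu m : (forall nu, wt_proj rho nu m != 0 -> nu = mu) ->
  m \in wt mu.
Proof.
move=> h; have [s [us sP ->]] := wt_proj_supp rho m.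
apply: memv_suml => nu _; have [->|/h ->] := eqVneq (wt_proj rho nu m) 0;
  first exact: mem0v.
exact: wt_proj_in.
Qed.

(** Elements of U^- need not be homogeneous, so induction over the generated algebra only confines
    the support to mu minus the root cone. *)
Lemma Uminus_act_supp (z : U r) mu : Uminus z -> forall m,
  (forall nu, wt_proj rho nu m != 0 -> exists c, nu = mu - rootsum c) ->
  forall nu, wt_proj rho nu (act rho z m) != 0 -> exists c, nu = mu - rootsum c.
Proof.
elim=> {z} [z [i _ <-]||x y _ IHx _ IHy|x y _ IHx _ IHy|a x _ IHx] m hm nu.
- rewrite (wt_proj_shift (@act_F _ _ rho i)) opprK => h.
  have : wt_proj rho (nu + alpha i) m != 0.
    by apply: contraNneq h => ->; rewrite raddf0.
  move=> /hm[c nuE]; exists [ffun j => (c j + (j == i))%N].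
  rewrite -[LHS](addrK (alpha i)) nuE -addrA -opprD; congr (mu - _).
  rewrite /rootsum [RHS](eq_bigr (fun j => alpha j *+ c j + alpha j *+ (j == i))).
    rewrite big_split; congr (_ + _); rewrite (bigD1 i) //= eqxx big1 ?addr0 //.
    by move=> j /negbTE ->.
  by move=> j _; rewrite ffunE mulrnDr.
- by rewrite act_one; exact: hm.
- rewrite act_add raddfD /= => h.
  have [x0|/(IHx _ hm) //] := eqVneq (wt_proj rho nu (act rho x m)) 0.
  by apply: (IHy _ hm); move: h; rewrite x0 add0r.
- by rewrite act_mul; apply: IHx; exact: IHy.
- rewrite act_scale linearZ_LR /= => h; apply: (IHx _ hm).
  by apply: contraNneq h => ->; rewrite scaler0.
Qed.

(** Conjugation by the K_i determines a weight only through its pairings with the simple roots;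
    inside mu minus the root cone this suffices, by [rootsum_eq]. *)
Lemma Uminus_wt_act c (z : U r) : Uminus_wt c z ->
  forall mu m, m \in wt mu -> act rho z m \in wt (mu - rootsum c).
Proof.
case=> zU zK mu m mw; apply: wt_of_proj => nu nu0.
have [|d nuE] := Uminus_act_supp (mu := mu) zU _ nu0.
  move=> nu'; rewrite (wt_proj_wt mw); have [->|_] := eqVneq nu' mu;
    last by rewrite eqxx.
  move=> _.
  by exists [ffun=> 0%N]; rewrite /rootsum big1 ?subr0 // => i _;
    rewrite ffunE mulr0n.
rewrite nuE; congr (_ - _); apply: rootsum_eq => i.
have Kz : K i * z = q ^ pairing (alpha i) (- rootsum c) *: z * K i.
  by rewrite -zK -[RHS]mulrA KvK mulr1.
have wz : Kwt rho i (pairing (alpha i) (mu - rootsum c)) (act rho z m).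
  rewrite /Kwt -act_mul Kz act_mul act_scale (act_K i mw) act_Z scalerA.
  by rewrite -expfzDr ?q_neq0 // raddfB /= raddfN /= addrC.
have := wt_proj_Kwt wz nu0; rewrite nuE !raddfB /=; lia.
Qed.

Lemma wt_ht_bound : exists H : nat, forall mu m, m \in wt mu -> m != 0 ->
  (`|lam_ht mu| <= H)%N.
Proof.
have [s us sP] := wt_finite rho;
  exists (\sum_(mu <- s) `|lam_ht mu|)%N => mu m mw m0.
by rewrite (bigD1_seq mu) //= ?leq_addr //; exact: sP mw m0.
Qed.

(** Heights of weights of M lie between -H and H, and z lowers the height by [ht c] > 2H. *)
Lemma Uminus_act_bound : exists B : nat, forall c z m,
  Uminus_wt c z -> (B <= ht c)%N -> act rho z m = 0.
Proof.
have [H HP] := wt_ht_bound; exists (H + H).+1 => c z m zc Bc; move: m.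
apply: (weight_ind (rho := rho)) => [|x y hx hy|mu x xw].
- by rewrite raddf0.
- by rewrite raddfD /= hx hy addr0.
have [->|x0] := eqVneq x 0; first by rewrite raddf0.
apply/eqP/negPn/negP => z0; have := HP _ _ (Uminus_wt_act zc xw) z0.
have := HP _ _ xw x0; rewrite raddfB /= lam_ht_rootsum; lia.
Qed.

Lemma filt_act n B (v : U r) m :
  (forall c z m, Uminus_wt c z -> (B <= ht c)%N -> act rho z m = 0) -> (B <= n)%N ->
  filt n v -> act rho v m = 0.
Proof.
move=> BP Bn; elim=> [|c x y z {}v nc _ _ zc _ IH];
  first by rewrite linear0 zero_lfunE.
by rewrite act_add IH addr0 act_mul (BP c z m zc (leq_trans Bn nc)) raddf0.
Qed.

Variables (psi psii : U r -> U r) (Ups : NPi r -> U r).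
Hypothesis UpsP : intertwiner psi psii Ups.

(** On M the completion can be avoided: Upsilon acts as a genuine element of U. *)
Lemma Ups_act_trunc : exists B : nat, forall n m, (B <= n)%N ->
  Ups_act rho Ups m = act rho (Ups_trunc Ups n) m.
Proof.
have [Uw _ _] := UpsP; have [B BP] := Uminus_act_bound; exists B => n m Bn.
pose h (e : {ffun idx r -> 'I_n}) : NPi r := [ffun i => e i : nat].
rewrite /Ups_act (fsum_seq (s := [seq h e | e <- enum {: {ffun idx r ->
  'I_n}} & (ht (h e) < n)%N])).
- rewrite big_map big_filter big_enum_cond /= /Ups_trunc.
  by move=> *; rewrite raddf_sum sum_lfunE.
- rewrite map_inj_uniq ?filter_uniq -?enumT ?enum_uniq // => e e' /ffunP ee'.
  by apply/ffunP => i; have := ee' i; rewrite !ffunE => /val_inj.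
move=> c c0; have hc : (ht c < B)%N.
  by rewrite ltnNge; apply: contraNN c0 => Bc; rewrite (BP _ _ _ (Uw c) Bc).
have ci i : (c i < n)%N.
  by apply: leq_ltn_trans (leq_trans hc Bn); rewrite /ht (bigD1 i) //= leq_addr.
apply/mapP; exists [ffun i => Ordinal (ci i)].
  rewrite mem_filter mem_enum andbT; apply: leq_trans (leq_trans hc Bn).
  by rewrite ltnS /ht; apply: leq_sum => i _; rewrite !ffunE.
by apply/ffunP => i; rewrite !ffunE.
Qed.

Lemma Ups_act_linear : linear (Ups_act rho Ups).
Proof.
by have [B BP] := Ups_act_trunc; move=> a x y; rewrite !(BP _ _ (leqnn B)) linearP.
Qed.
(** An equality in the completion holds modulo every [filt N] for large n, and [filt B'] acts by 0
    on M. *)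
Lemma Ups_act_intertwine u m : Uiota u ->
  act rho (psii u) (Ups_act rho Ups m) = Ups_act rho Ups (act rho (psi u) m).
Proof.
move=> uI; have [_ _ /(_ u uI) eqU] := UpsP.
have [B BP] := Ups_act_trunc; have [B' BP'] := Uminus_act_bound.
have [n0 /(_ (maxn n0 B) (leq_maxl _ _)) hf] := eqU B'.
rewrite !(BP _ _ (leq_maxr n0 B)) -!act_mul; apply/eqP; rewrite -subr_eq0 -act_sub.
by rewrite (filt_act m BP' (leqnn _) hf).
Qed.

Lemma Ups_act_proj mu m : exists s : seq (NPi r), 
  wt_proj rho mu (Ups_act rho Ups m) = wt_proj rho mu m +
  \sum_(c <- s | c != [ffun=> 0%N]) act rho (Ups c) (wt_proj rho (mu + rootsum c)
    m).
Proof.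
have [Uw U0 _] := UpsP; have [B BP] := Ups_act_trunc.
(* The bound [B.+1] is positive, so the truncation contains c = 0. *)
pose h (e : {ffun idx r -> 'I_B.+1}) : NPi r := [ffun i => e i : nat].
pose s := [seq h e | e <- enum {: {ffun idx r -> 'I_B.+1}} & (ht (h e) < B.+1)%N].
have us : uniq s.
  rewrite map_inj_uniq ?filter_uniq -?enumT ?enum_uniq // => e e' /ffunP ee'.
  by apply/ffunP => i; have := ee' i; rewrite !ffunE => /val_inj.
have s0 : [ffun=> 0%N] \in s.
  apply/mapP; exists [ffun=> ord0]; last by apply/ffunP => i; rewrite !ffunE.
  by rewrite mem_filter mem_enum andbT /ht big1 // => i _; rewrite !ffunE.
exists s; rewrite (BP B.+1 m (leqnSn B)).
have -> : act rho (Ups_trunc Ups B.+1) m = \sum_(c <- s) act rho (Ups c) m.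
  by rewrite big_map big_filter big_enum_cond /= /Ups_trunc raddf_sum sum_lfunE.
rewrite raddf_sum (bigD1_seq _ s0 us) /= U0 act_one; congr (_ + _);
  apply: eq_bigr => c _.
rewrite (wt_proj_shift (b := - rootsum c)) ?opprK //; exact: Uminus_wt_act.
Qed.

(** By [Ups_act_proj], a component of a vector in the kernel is determined by components of larger
    height, so all of them vanish by descending induction from the bound H. *)
Lemma Ups_act_inj : injective (Ups_act rho Ups).
Proof.
have [Uw U0 _] := UpsP.
suff ker m : Ups_act rho Ups m = 0 -> m = 0.
  move=> x y xy; apply/eqP; rewrite -subr_eq0; apply/eqP/ker.
  by rewrite addrC -scaleN1r Ups_act_linear xy scaleN1r addNr.
move=> Um; have [H HP] := wt_ht_bound.
have van k mu : H%:Z - k%:Z < lam_ht mu -> wt_proj rho mu m = 0.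
  elim: k mu => [|k IH] mu hk.
    apply/eqP/negPn/negP => h0; have := HP _ _ (wt_proj_in rho mu m) h0; lia.
  have [s] := Ups_act_proj mu m; rewrite Um raddf0 big1 ?addr0 // => c c0.
  rewrite IH ?raddf0 // raddfD /= lam_ht_rootsum.
  have : (0 < ht c)%N; last by lia.
  rewrite lt0n; apply: contraNneq c0 => h0; apply/eqP/ffunP => i; rewrite ffunE.
  by apply/eqP; rewrite -leqn0 -h0 /ht (bigD1 i) //= leq_addr.
have [s [_ _ ->]] := wt_proj_supp rho m; rewrite big1 // => mu _.
by apply: (van (absz (H%:Z - lam_ht mu)).+1 mu); lia.
Qed.

End Upsilon.

(** * The twist by zeta and the theorem *)

Lemma bar_evalMX (p : {poly rat}) : bar_eval ('X * p) = q^-1 * bar_eval p.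
Proof.
pose phi : {rmorphism rat -> Qq} := @tofrac {poly rat} \o @polyC rat.
have barE p' : bar_eval p' = (map_poly phi p').[q^-1] by [].
by rewrite !barE rmorphM /= map_polyX hornerM hornerX.
Qed.

(* If the denominator representing [q] evaluated to 0, the division by it
   would give [bar q = 0]. *)
Lemma bar_q : bar q != 0 -> bar q = q^-1.
Proof.
have nE : \n_(repr q) = 'X * \d_(repr q).
  have := @FracField.equivf_l {poly rat} (Ratio 'X 1).
  have -> : q = (\pi_Qq (Ratio 'X 1))%qT by rewrite /q; unlock FracField.tofrac.
  by rewrite !numden_Ratio ?oner_eq0 // mulr1 mulrC.
have barE : bar q = q^-1 * (bar_eval \d_(repr q) / bar_eval \d_(repr q)).
  by rewrite /bar nE bar_evalMX mulrA.
rewrite barE mulf_eq0 negb_or mulf_eq0 negb_or => /and3P[_ d0 _].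
by rewrite divff // mulr1.
Qed.

(** * The composite of psi and psi_i on the generators *)

Section BarInvolution.
Variables (r : nat) (psi psii : U r -> U r).
Hypothesis psiP : bar_involution psi.
Hypothesis psiiP : ibar_involution psii.
Implicit Type i : idx r.

Lemma psi_q (u : U r) : psi (q *: u) = q^-1 *: psi u.
Proof.
have [[[_ psiK] _ psiD _ psiZ] _] := psiP; rewrite psiZ // bar_q //.
have psi0 : psi 0 = 0 by apply: (addrI (psi 0)); rewrite -psiD // !addr0.
(* If [bar q] were 0, then psi would kill q 1, contradicting that psi is an involution. *)
apply/eqP => b0; have := psiK (q *: 1) I; rewrite psiZ // b0 scale0r psi0.
by move/esym/eqP; rewrite scaler_eq0 oner_eq0 orbF (negbTE q_neq0).
Qed.

Lemma psi_Kv i : psi (Kv i) = K i.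
Proof.
have [[[_ psiK] _ _ _ _] /(_ i)[_ _ pK]] := psiP.
by rewrite -pK psiK.
Qed.

Lemma psi_psii_kI i : (mid r < i)%N ->
  psi (psii (kI i)) = kI i /\ psi (psii (kvI i)) = kvI i.
Proof.
move=> ri; have [[[_ psiK] _ _ psiM _] gen] := psiP.
have [[[_ psiiK] _ _ _ _] _ /(_ i ri)[_ _ pk]] := psiiP.
have psiKE j : psi (K j) = Kv j by have [] := gen j.
have -> : psii (kvI i) = kI i.
  by rewrite -pk psiiK //; apply: subalg_mem; right; exists i => //; constructor 1.
by rewrite pk /kI /kvI !psiM // !psi_Kv !psiKE.
Qed.

Lemma psi_psii_eI i : (mid r < i)%N ->
  psi (psii (eI i)) = E i + K i * F (rev_ord i).
Proof.
move=> ri; have [[_ _ psiD psiM _] gen] := psiP.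
have [_ _ /(_ i ri)[-> _ _]] := psiiP.
have [pE _ _] := gen i; have [_ pF _] := gen (rev_ord i).
by rewrite /eI psiD // psiM // pE pF psi_Kv.
Qed.

Lemma psi_psii_fI i : (mid r < i)%N ->
  psi (psii (fI i)) = F i * K (rev_ord i) + E (rev_ord i).
Proof.
move=> ri; have [[_ _ psiD psiM _] gen] := psiP.
have [_ _ /(_ i ri)[_ -> _]] := psiiP.
have [_ pF _] := gen i; have [pE _ _] := gen (rev_ord i).
by rewrite /fI psiD // psiM // pE pF psi_Kv.
Qed.

Lemma psi_psii_tI : psi (psii (tI r)) =
  E (mid r) + q^-1 *: (F (mid r) * K (mid r)) + K (mid r).
Proof.
have [[_ _ psiD psiM _] gen] := psiP; have [_ -> _] := psiiP.
have [pE pF _] := gen (mid r).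
by rewrite /tI !psiD // psi_q psiM // pE pF psi_Kv.
Qed.

End BarInvolution.

Lemma expz_cancel (R : fieldType) (p : R) (a b c : int) (z : R) :
  p != 0 -> a + b + c = 0 -> p ^ a * p ^ b * (- p ^ c * z) = - z.
Proof.
by move=> p0 abc; rewrite mulNr mulrN mulrA -!expfzDr // abc expr0z mul1r.
Qed.

Section ZetaTilde.
Variables (r : nat) (M : vectType Qq) (rho : weight_module r M) (zeta : Lam r ->
  Qq).
Hypothesis zetaP : zeta_function zeta.
Local Notation wt := (Defs.wt rho).
Local Notation Z := (zeta_tilde rho zeta).
Implicit Types (mu nu : Lam r) (m x : M) (i j : idx r).

Lemma zeta_sum (s : seq (Lam r)) m : uniq s ->
  (forall mu m, m \in wt mu -> m != 0 -> mu \in s) ->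
  Z m = \sum_(mu <- s) zeta mu *: wt_proj rho mu m.
Proof.
move=> us sP; apply: fsum_seq => // mu; apply: contraNT => ls.
rewrite (_ : wt_proj rho mu m = 0) ?scaler0 //; apply/eqP; apply: contraNT ls.
by apply: sP; exact: wt_proj_in.
Qed.

Lemma zeta_tilde_linear : linear Z.
Proof.
have [s us sP] := wt_finite rho; move=> a x y; rewrite !(zeta_sum _ us sP).
rewrite scaler_sumr -big_split; apply: eq_bigr => mu _ /=.
by rewrite linearP scalerDr !scalerA mulrC.
Qed.
HB.instance Definition _ :=
  GRing.isLinear.Build Qq M M _ Z zeta_tilde_linear.

Lemma zeta_tilde_wt mu m : m \in wt mu -> Z m = zeta mu *: m.
Proof.
move=> mw; have [s us sP] := wt_finite rho; rewrite (zeta_sum m us sP).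
have [->|m0] := eqVneq m 0.
  by rewrite scaler0 big1 // => nu _; rewrite raddf0 scaler0.
rewrite (bigD1_seq mu) //=; last exact: sP mw m0.
rewrite (wt_proj_wt mw) eqxx big1 ?addr0 // => nu /negbTE nl.
by rewrite (wt_proj_wt mw) nl scaler0.
Qed.

Lemma zeta_tilde_surj y : exists x, Z x = y.
Proof.
have [z0 _ _] := zetaP; move: y; apply: (weight_ind (rho := rho)).
- by exists 0; rewrite raddf0.
- by move=> x y [x' <-] [y' <-]; exists (x' + y'); rewrite raddfD.
move=> mu x xw; exists ((zeta mu)^-1 *: x).
by rewrite linearZ_LR /= (zeta_tilde_wt xw) scalerA (mulVf (z0 mu)) scale1r.
Qed.

Lemma zeta_Z_comm (u : U r) : (forall mu m, m \in wt mu -> act rho u m \in wt mu) ->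
  forall x, Z (act rho u x) = act rho u (Z x).
Proof.
move=> uw; apply: (weight_ind (rho := rho)) => [|x y hx hy|mu x xw].
- by rewrite !raddf0.
- by rewrite !raddfD /= hx hy.
by rewrite (zeta_tilde_wt (uw _ _ xw)) (zeta_tilde_wt xw) act_Z.
Qed.

Lemma act_K_wt i mu m : m \in wt mu -> act rho (K i) m \in wt mu.
Proof. by move=> mw; rewrite (act_K i mw) memvZ. Qed.

Lemma act_Kv_wt i mu m : m \in wt mu ->
  act rho (Kv i) m = q ^ (- pairing (alpha i) mu) *: m.
Proof. by move=> mw; exact/Kwt_Kv/wt_Kwt. Qed.

(* The two recursions for [zeta] are what makes conjugation by [zeta_tilde]
   turn the images of e_i and f_i under T_{w_0} into psi(e_i) and psi(f_i). *)
Lemma zeta_E i x : i != mid r -> pairing (alpha i) (alpha (rev_ord i)) = 0 ->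
  Z (act rho (K (rev_ord i) * Kv i * E i) x) = - act rho (E i) (Z x).
Proof.
have [_ _ zi] := zetaP; move=> im ai; move: x;
  apply: (weight_ind (rho := rho)) => [|x y hx hy|mu x xw].
- by rewrite !raddf0.
- by rewrite !raddfD /= hx hy.
have Ew := act_E i xw; rewrite !act_mul (act_Kv_wt _ Ew) act_Z (act_K _ Ew) scalerA.
rewrite linearZ_LR /= (zeta_tilde_wt Ew) (zeta_tilde_wt xw) act_Z scalerA -scaleNr.
congr (_ *: _); rewrite zi // expz_cancel ?q_neq0 //.
rewrite (raddfD (pairing (alpha (rev_ord i)))) /= (pairingC (alpha (rev_ord i))
  (alpha i)) ai.
lia.
Qed.

Lemma zeta_F i x : i != mid r ->
  Z (act rho (F i * K i) x) = - act rho (K (rev_ord i) * F i) (Z x).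
Proof.
have [_ _ zi] := zetaP; move=> im; move: x;
  apply: (weight_ind (rho := rho)) => [|x y hx hy|mu x xw].
- by rewrite !raddf0.
- by rewrite !raddfD /= hx hy.
have Fw := act_F i xw;
  rewrite !act_mul (zeta_tilde_wt xw) !act_Z (act_K i xw) act_Z.
rewrite linearZ_LR /= (zeta_tilde_wt Fw) (act_K _ Fw) !scalerA -scaleNr.
(* F_i lowers the weight, so the recursion is applied at mu - alpha_i. *)
congr (_ *: _); rewrite -[in RHS](subrK (alpha i) mu) zi // subrK.
by rewrite !mulNr opprK [RHS]mulrAC -expfzDr ?q_neq0 // subrK.
Qed.

Lemma zeta_E0 x : Z (act rho (E (mid r)) x) = - q *: act rho (E (mid r)) (Z x).
Proof.
have [_ zm _] := zetaP; move: x;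
  apply: (weight_ind (rho := rho)) => [|x y hx hy|mu x xw].
- by rewrite !raddf0.
- by rewrite !raddfD /= hx hy.
by rewrite (zeta_tilde_wt (act_E _ xw)) (zeta_tilde_wt xw) act_Z scalerA zm.
Qed.

Lemma zeta_F0 x : Z (act rho (F (mid r)) x) = - q^-1 *: act rho (F (mid r)) (Z x).
Proof.
have [_ zm _] := zetaP; move: x;
  apply: (weight_ind (rho := rho)) => [|x y hx hy|mu x xw].
- by rewrite !raddf0.
- by rewrite !raddfD /= hx hy.
rewrite (zeta_tilde_wt (act_F _ xw)) (zeta_tilde_wt xw) act_Z scalerA.
rewrite -{2}[mu](subrK (alpha (mid r))) zm mulrA mulrNN mulVf ?q_neq0 // mul1r //.
Qed.

End ZetaTilde.

Section LinearBijections.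
Variables (K : fieldType) (M : vectType K) (f : {linear M -> M}).

Lemma linear_inj_bij : injective f -> bijective f.
Proof.
move=> fi; have g0 : lker (linfun f) == 0%VS.
  by apply/lker0P => x y; rewrite !lfunE; exact: fi.
exists (linfun f)^-1%VF => x.
  by rewrite -{1}(lfunE f) lker0_lfunK.
by rewrite -{1}(lfunE f) lker0_lfunVK.
Qed.

Lemma linear_surj_bij : (forall y, exists x, f x = y) -> bijective f.
Proof.
move=> fs; apply: linear_inj_bij => x y; rewrite -!(lfunE f); apply/lker0P.
have im : limg (linfun f) = fullv.
  apply/eqP; rewrite eqEsubv subvf /=; apply/subvP => z _.
  by have [x0 <-] := fs z; rewrite -(lfunE f) memv_img ?memvf.
have := limg_ker_dim (linfun f) fullv; rewrite im capfv => h.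
by rewrite -dimv_eq0 (canRL (addnK _) h) subnn.
Qed.

End LinearBijections.

Lemma KvK_comm (r : nat) (i j : idx r) : Kv i * K j = K j * Kv i.
Proof.
rewrite -[LHS]mulr1 -(KKv i) -mulrA [K j * _]mulrA -KK.
by rewrite !mulrA KvK mul1r.
Qed.

Lemma mul_expzN2 (R : fieldType) (p : R) : p != 0 -> p * p ^ (- 2%:Z) * p = 1.
Proof. by move=> p0; rewrite -invr_expz -exprnP; field. Qed.

(** * The generators of U^i under T_{w_0} followed by zeta *)

Section Intertwining.
Variables (r : nat) (M : vectType Qq) (rho : weight_module r M).
Variables (zeta : Lam r -> Qq) (w : seq (idx r)).
Hypothesis zetaP : zeta_function zeta.
Hypothesis wP : longest_reduced w.
Local Notation T := (braid_word rho w).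
Local Notation Z := (zeta_tilde rho zeta).
Implicit Types (i : idx r) (m : M).

Lemma braid_longest_Kv i m :
  T (act rho (Kv i) m) = act rho (K (rev_ord i)) (T m).
Proof.
have [_ _ TK] := braid_longest rho i wP.
have {2}-> : m = act rho (K i) (act rho (Kv i) m) by rewrite -act_mul KKv act_one.
by rewrite TK -act_mul KKv act_one.
Qed.

Lemma rev_mid : rev_ord (mid r) = mid r.
Proof. by apply: val_inj; rewrite /=; lia. Qed.

Section PositiveIndex.
Variable i : idx r.
Hypothesis ri : (mid r < i)%N.

(** For i > 0 the indices i and -i are at distance at least 2. *)
Let ir : pairing (alpha i) (alpha (rev_ord i)) = 0.
Proof. by apply: cartan_far; move: ri => /=; have := ltn_ord i; lia. Qed.

Let im : i != mid r.
Proof. by apply/eqP => h; move: ri; rewrite h ltnn. Qed.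

Let im' : rev_ord i != mid r.
Proof. by rewrite -rev_mid (inj_eq rev_ord_inj). Qed.

Lemma ZT_kI m : Z (T (act rho (kI i) m)) = act rho (kI i) (Z (T m)).
Proof.
have [_ _ TK] := braid_longest rho i wP.
rewrite /kI act_mul TK braid_longest_Kv rev_ordK -act_mul KvK_comm zeta_Z_comm //.
move=> mu x xw; rewrite act_mul; apply: act_K_wt.
by rewrite (act_Kv_wt _ xw) memvZ.
Qed.

Lemma ZT_kvI m : Z (T (act rho (kvI i) m)) = act rho (kvI i) (Z (T m)).
Proof.
have [_ _ TK] := braid_longest rho (rev_ord i) wP.
rewrite /kvI act_mul braid_longest_Kv TK rev_ordK -act_mul -KvK_comm zeta_Z_comm //.
move=> mu x xw; rewrite act_mul (act_Kv_wt _ (act_K_wt _ xw)) memvZ //.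
exact: act_K_wt.
Qed.

(** The two summands trade places: T_{w_0} turns E_i into - F_{-i} K_{-i}, which zeta turns into K_i
    F_{-i}; and it turns K_i^-1 F_{-i} into - K_{-i} K_i^-1 E_i, which zeta turns into E_i. *)
Lemma ZT_eI m : Z (T (act rho (eI i) m)) =
  act rho (E i + K i * F (rev_ord i)) (Z (T m)).
Proof.
have [TE _ _] := braid_longest rho i wP.
have [_ TF _] := braid_longest rho (rev_ord i) wP.
rewrite /eI act_add raddfD /= TE act_mul braid_longest_Kv TF rev_ordK.
rewrite (raddfN (act rho (K _))) /= -!act_mul raddfD /= !raddfN /= mulrA.
rewrite (zeta_E rho zetaP) // (zeta_F rho zetaP) // !opprK rev_ordK.
by rewrite addrC act_add.
Qed.

Lemma ZT_fI m : Z (T (act rho (fI i) m)) =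
  act rho (F i * K (rev_ord i) + E (rev_ord i)) (Z (T m)).
Proof.
have [_ TF _] := braid_longest rho i wP.
have [TE _ _] := braid_longest rho (rev_ord i) wP.
rewrite /fI act_add raddfD /= TE act_mul TF braid_longest_Kv rev_ordK.
have -> x : act rho (E (rev_ord i)) (act rho (K i) x) =
  act rho (K i) (act rho (E (rev_ord i)) x).
  by rewrite KE_act ir expr0z scale1r.
rewrite -!act_mul raddfD /= !raddfN /= KvK_comm.
have := zeta_E rho zetaP (T m) im'; rewrite rev_ordK pairingC ir => -> //.
rewrite (zeta_F rho zetaP) // !opprK addrC act_add act_mul KF_act.
by rewrite pairingC ir oppr0 expr0z scale1r -act_mul.
Qed.

End PositiveIndex.

(** E_0 and q F_0 K_0^-1 trade places, and K_0^-1 becomes K_0. As K_0^-1 E_0 K_0 = q^-2 E_0, the new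
    coefficient of E_0 is q q^-2 q = 1. *)
Lemma ZT_tI m : Z (T (act rho (tI r) m)) =
  act rho (E (mid r) + q^-1 *: (F (mid r) * K (mid r)) + K (mid r)) (Z (T m)).
Proof.
have [TE TF _] := braid_longest rho (mid r) wP.
have TD a b : T (a + b) = T a + T b by exact: raddfD.
have TZ a b : T (a *: b) = a *: T b by exact: linearZ_LR.
have ZD a b : Z (a + b) = Z a + Z b by exact: raddfD.
have ZZ a b : Z (a *: b) = a *: Z b by exact: linearZ_LR.
have ZN a : Z (- a) = - Z a by exact: raddfN.
rewrite /tI !act_add !act_scale !act_mul !TD TZ TE TF !braid_longest_Kv rev_mid.
set y := T m.
have -> : act rho (E (mid r)) (act rho (K (mid r)) y) =
    q ^ (- 2%:Z) *: act rho (K (mid r)) (act rho (E (mid r)) y).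
  rewrite KE_act cartan_diag scalerA -expfzDr ?q_neq0 //.
  by rewrite (_ : _ + _ = 0) ?expr0z ?scale1r //; lia.
rewrite act_Z -(act_mul rho (Kv _) (K _)) KvK act_one.
have ZK x : Z (act rho (K (mid r)) x) = act rho (K (mid r)) (Z x).
  by apply: zeta_Z_comm => mu z; exact: act_K_wt.
rewrite !ZD ZZ !ZN ZZ ZK (zeta_F0 rho zetaP) ZK (zeta_E0 rho zetaP).
rewrite scaleNr opprK; congr (_ + _); rewrite addrC; congr (_ + _).
rewrite scalerN !scalerA -scaleNr.
rewrite -[RHS]scale1r; congr (_ *: _).
by rewrite mulrN opprK mul_expzN2 // q_neq0.
Qed.

End Intertwining.

Local Close Scope ring_scope.
Local Close Scope classical_set_scope.

Theorem theorem2p18 (r : nat) (M : vectType Qq) (rho : weight_module r M)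
  (psi psii : U r -> U r) (Ups : {ffun 'I_(r.*2.+1) -> nat} -> U r)
  (zeta : 'rV[int]_(r.*2.+2) -> Qq) (w0 : seq 'I_(r.*2.+1)) :
  bar_involution psi -> ibar_involution psii ->
  intertwiner psi psii Ups -> zeta_function zeta -> longest_reduced w0 ->
  Uiota_isomorphism rho
    (Ups_act rho Ups \o zeta_tilde rho zeta \o braid_word rho w0).
Proof.
move=> psiP psiiP UpsP zetaP wP.
have Ulin := Ups_act_linear rho UpsP.
pose Y : {linear M -> M} := HB.pack (Ups_act rho Ups)
  (GRing.isLinear.Build Qq M M _ (Ups_act rho Ups) Ulin).
pose A : {linear M -> M} := (Y \o zeta_tilde rho zeta \o braid_word rho w0)%FUN.
split; first by move=> a x y; exact: (linearP A).
  apply: (linear_surj_bij (f := A)) => y.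
  (* Upsilon is known to be injective and the other two factors to be onto; finite dimension turns
     the former into surjectivity. *)
  have [Yi YK YiK] := linear_inj_bij (f := Y) (Ups_act_inj UpsP).
  have [z zE] := zeta_tilde_surj rho zetaP (Yi y).
  have [x xE] := braid_word_surjective rho w0 z.
  by exists x; rewrite /A /= xE zE; exact: YiK.
have [[[psiiS psiiK] _ _ _ _] _ _] := psiiP.
have gen u : Uiota u ->
  (forall m, zeta_tilde rho zeta (braid_word rho w0 (act rho u m)) =
      act rho (psi (psii u)) (zeta_tilde rho zeta (braid_word rho w0 m))) ->
    forall m, A (act rho u m) = act rho u (A m).
  move=> uI h m; rewrite /A /= h -(Ups_act_intertwine rho UpsP _ (psiiS _ uI)).
  by rewrite psiiK.
(* The u whose action commutes with A are closed under the algebra operations, so psi and psi_i have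
   to be computed on generators only. *)
move=> u; elim=> {u} [u gu||u v _ IHu _ IHv|u v _ IHu _ IHv|a u _ IHu] m.
- apply: gen; first exact: subalg_mem.
  case: gu => [->|[i ri [] ->]] {u m} m.
  + by rewrite (psi_psii_tI psiP psiiP) (ZT_tI rho zetaP wP).
  + by rewrite (psi_psii_kI psiP psiiP ri).1 (ZT_kI rho zeta wP).
  + by rewrite (psi_psii_kI psiP psiiP ri).2 (ZT_kvI rho zeta wP).
  + by rewrite (psi_psii_eI psiP psiiP ri) (ZT_eI rho zetaP wP).
  + by rewrite (psi_psii_fI psiP psiiP ri) (ZT_fI rho zetaP wP).
- by rewrite !act_one.
- by rewrite !act_add -IHu -IHv -[LHS]/(A _) raddfD.
- by rewrite !act_mul IHu IHv.
- by rewrite !act_scale -IHu -[LHS]/(A _) linearZ_LR.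
Qed.
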